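(* Let $(E,f,S)$ be a finite almost entropic partial Dowling geometry of rank $4$. Then there exists an extension $(\tilde{E},\tilde{f},\tilde{S})$ of $(E,f,S)$ which is again an almost entropic partial Dowling geometry of rank $4$, such that for all $s,s'\in\tilde{S}$ (not necessarily distinct) there exists a geometric product $t\in\tilde{S}$ of $s,s'$.
   Context: A polymatroid is $(E,f)$ with $f:\mathcal{P}(E)\to\mathbb{R}$, $f(\emptyset)=0$, monotone, submodular (and of finite type, $f(S)=\sup_{F\subseteq S\text{ finite}}f(F)$, if $E$ is infinite); $f(a_1,\dots,a_k):=f(\{a_1,\dots,a_k\})$ and $\mathrm{cl}(A)=\{x\in E\mid f(A\cup\{x\})=f(A)\}$. A polymatroid is entropic if $f(S)=H((X_i)_{i\in S})$ for random variables $(X_i)_{i\in E}$ on a finite probability space (Shannon entropy), and almost entropic if it is of finite type and a pointwise limit of entropic polymatroids on $E$. A partial Dowling geometry (PDG) of rank $r$ is a triple $(E,f,S)$ where $(E,f)$ is a polymatroid and: (1) $S$ is a set with an involution $s\mapsto s^{-1}$ and a distinguished element $e$ with $e^{-1}=e$; (2) $E$ contains $B=\{b_1,\ldots,b_r\}$ with $f(A)=|A|$ for all $A\subseteq B$; (3) for each $1\le i<j\le r$, $E$ contains a copy $\{s_{i,j}\mid s\in S\}$ of $S$, these copies pairwise disjoint and disjoint from $B$, and $E=B\sqcup\bigsqcup_{i<j}\{s_{i,j}\mid s\in S\}$; one sets $s_{i,j}^{-1}:=(s^{-1})_{i,j}$, and for $i<j$, $s_{j,i}:=s_{i,j}^{-1}$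 and $s_{j,i}^{-1}:=s_{i,j}$; (4) $s_{i,j}\in\mathrm{cl}(b_i,b_j)$ for all distinct $i,j$; (5) $f(s_{i,j})=1$ and $f(b_i,s_{i,j})=2$ for all $s\in S$ and distinct $i,j$; (6) $f(s_{i,j},s^{-1}_{j,k},e_{k,i})=2$ for all $s\in S$ and distinct $i,j,k$. The PDG is finite if $E$ is finite, and almost entropic if $(E,f)$ is. A relator is a triple $(s,s',s'')\in S^3$ with $f(s_{i,j},s'_{j,k},s''_{k,i})=2$ for all pairwise distinct $i,j,k$; a geometric product of $s,s'$ is $t\in S$ such that $(s,s',t^{-1})$ is a relator. A PDG $(\tilde E,\tilde f,\tilde S)$ of the same rank is an extension of $(E,f,S)$ if $E\subseteq\tilde E$, $\tilde f\restriction_{\mathcal{P}(E)}=f$, $S\subseteq\tilde S$ with involution and $e$ extending those of $S$, and the elements $b_i$, $s_{i,j}$ of $E$ are the corresponding elements of $\tilde E$. *)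

(* Defs.v *)
From mathcomp Require Import all_boot all_order all_algebra.
From mathcomp Require Import all_classical all_reals all_analysis.

Set Implicit Arguments.
Unset Strict Implicit.
Unset Printing Implicit Defensive.

Import Order.TTheory GRing.Theory Num.Theory.
Import numFieldNormedType.Exports.

Local Open Scope classical_set_scope.
Local Open Scope ring_scope.

Section Polymatroids.
Variables (R : realType) (E : Type).

(* For a monotone [f] the set below is bounded by [f A], so that [sup] is a
   genuine supremum. *)
Definition finite_type (f : set E -> R) : Prop :=
  forall A, f A = sup [set f F | F in [set F | finite_set F /\ F `<=` A]].

Record polymatroid : Type := Polymatroid {
  pm_rank :> set E -> R;
  pm_set0 : pm_rank set0 = 0;
  pm_mono : forall A B, A `<=` B -> pm_rank A <= pm_rank B;
  pm_submod : forall A B,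
    pm_rank (A `|` B) + pm_rank (A `&` B) <= pm_rank A + pm_rank B;
  pm_fintype : infinite_set [set: E] -> finite_type pm_rank }.

Definition cl (f : polymatroid) (A : set E) : set E :=
  [set x | f (A `|` [set x]) = f A].

End Polymatroids.

Section Entropy.
Variables (R : realType) (Omega : finType) (p : Omega -> R).

Definition is_distribution : Prop :=
  (forall w, 0 <= p w) /\ \sum_w p w = 1.

Definition prob_eq (T : Type) (Y : Omega -> T) (y : T) : R :=
  \sum_(w | `[< Y w = y >]) p w.

(* Entropy in nats; values of probability zero contribute [0 * ln 0 = 0]. *)
Definition entropy (T : Type) (Y : Omega -> {classic T}) : R :=
  - \sum_(y \in range Y) prob_eq Y y * ln (prob_eq Y y).

(* The joint random variable of the [X i] for [i] in [A]; it takes values in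
   the product of the [V i] over [i] in [A], also when [A] is infinite. *)
Definition joint (E : Type) (V : E -> Type)
    (X : forall i, Omega -> V i) (A : set E) :
    Omega -> {classic forall i : A, V (\val i)} :=
  fun w i => X (\val i) w.

End Entropy.

Arguments joint {Omega E V} X A.

Definition entropic (R : realType) (E : Type) (f : polymatroid R E) : Prop :=
  exists (Omega : finType) (p : Omega -> R) (V : E -> Type)
         (X : forall i, Omega -> V i),
    is_distribution p /\ forall A, f A = entropy p (joint X A).

Definition almost_entropic (R : realType) (E : Type) (f : polymatroid R E) :
    Prop :=
  finite_type f /\
  exists g : nat -> polymatroid R E,
    (forall n, entropic (g n)) /\
    (forall A, (fun n => g n A) @ \oo --> f A).

(* Rank-[r] candidates for a partial Dowling geometry. Indices run over
   {0, ..., r-1}. Only the values [copy i j s] with [i < j] are meaningful;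
   elements are always accessed through [elt] below. *)
Record pdg_data (R : realType) (r : nat) : Type := PDGData {
  ground : Type;
  rk : polymatroid R ground;
  symb : Type;
  sinv : symb -> symb;
  sid : symb;
  basis : 'I_r -> ground;
  copy : 'I_r -> 'I_r -> symb -> ground }.

Arguments sid {R r} p.
Arguments basis {R r} p _.

(* [elt i j s] is s_{i,j}, with s_{j,i} := (s^{-1})_{i,j} for i < j. *)
Definition elt (R : realType) (r : nat) (D : pdg_data R r) (i j : 'I_r)
    (s : symb D) : ground D :=
  if (i < j)%N then copy i j s else copy j i (sinv s).

Record is_pdg (R : realType) (r : nat) (D : pdg_data R r) : Prop := IsPDG {
  pdg_invK : involutive (@sinv _ _ D);
  pdg_inv_e : sinv (sid D) = sid D;
  pdg_b_inj : injective (basis D);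
  pdg_b_rank : forall A : {set 'I_r},
    rk D [set basis D i | i in [set` A]] = #|A|%:R;
  (* the copies of [symb D] for i < j, each injective and pairwise disjoint *)
  pdg_elt_inj : forall (i j k l : 'I_r) (s t : symb D),
    (i < j)%N -> (k < l)%N ->
    elt i j s = elt k l t -> [/\ i = k, j = l & s = t];
  pdg_elt_b : forall (i j k : 'I_r) (s : symb D),
    (i < j)%N -> elt i j s <> basis D k;
  pdg_cover : forall x : ground D,
    (exists k, x = basis D k) \/
    (exists (i j : 'I_r) (s : symb D), (i < j)%N /\ x = elt i j s);
  pdg_cl : forall (i j : 'I_r) (s : symb D), i <> j ->
    cl (rk D) [set basis D i; basis D j] (elt i j s);
  pdg_rank_elt : forall (i j : 'I_r) (s : symb D), i <> j ->
    rk D [set elt i j s] = 1 /\ rk D [set basis D i; elt i j s] = 2;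
  pdg_triangle : forall (i j k : 'I_r) (s : symb D),
    i <> j -> j <> k -> i <> k ->
    rk D [set elt i j s; elt j k (sinv s); elt k i (sid D)] = 2 }.

Record pdg (R : realType) (r : nat) : Type := PDG {
  pdg_car :> pdg_data R r;
  pdgP : is_pdg pdg_car }.

Definition pdg_finite (R : realType) (r : nat) (D : pdg R r) : Prop :=
  finite_set [set: ground D].

Definition pdg_almost_entropic (R : realType) (r : nat) (D : pdg R r) : Prop :=
  almost_entropic (rk D).

Definition relator (R : realType) (r : nat) (D : pdg R r)
    (s1 s2 s3 : symb D) : Prop :=
  forall i j k : 'I_r, i <> j -> j <> k -> i <> k ->
    rk D [set elt i j s1; elt j k s2; elt k i s3] = 2.

Definition geometric_product (R : realType) (r : nat) (D : pdg R r)
    (s1 s2 t : symb D) : Prop :=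
  relator s1 s2 (sinv t).

(* The inclusions of ground sets and of symbol sets are rendered by
   injections [iE] and [iS]. *)
Definition extension (R : realType) (r : nat) (D D' : pdg R r) : Prop :=
  exists (iE : ground D -> ground D') (iS : symb D -> symb D'),
    injective iE /\ injective iS /\
    (forall A, rk D' (iE @` A) = rk D A) /\
    (forall s, iS (sinv s) = sinv (iS s)) /\
    iS (sid D) = sid D' /\
    (forall i, iE (basis D i) = basis D' i) /\
    (forall (i j : 'I_r) (s : symb D), (i < j)%N ->
       iE (elt i j s) = elt i j (iS s)).

(* Main.v *)
(* A point t_{ik} = s s' on the line b_i b_k is obtained by contracting s_{ij}:
   in the contraction s'_{jk} lies on that line.  Since s_{ij} is independent of
   F = {b_i, b_k, s_{il}, s'_{lk}} (l the fourth index), one may replace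
   (s_{ij}, s'_{jk}) by a copy that is conditionally independent of everything
   else given F; the copy of s_{ij} is then independent of the whole ground set,
   and contracting it keeps f and adds t_{ik}.  Almost entropic functions are
   closed under copies (by compactness) and under contraction (they form a
   closed convex cone).  By construction t_{ik} lies on the line s_{il} s'_{lk};
   submodularity applied to two planes in the rank-4 geometry puts it on
   s_{ij} s'_{jk} as well, and likewise yields the triangles required of a new
   symbol.  Adding products one at a time and passing to the limit closes the
   symbol set under products. *)
Require Import Defs.
From mathcomp Require Import all_boot all_order all_algebra.
From mathcomp Require Import all_classical all_reals all_analysis.
From mathcomp Require Import ring lra.

Set Implicit Arguments.
Unset Strict Implicit.
Unset Printing Implicit Defensive.

Import Order.TTheory GRing.Theory Num.Theory.
Import numFieldNormedType.Exports.

Local Open Scope classical_set_scope.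
Local Open Scope ring_scope.

(** * Entropy of equivalence relations on a finite probability space *)

Section RelationEntropy.
Variables (R : realType) (Omega : finType).
Implicit Types (p : Omega -> R) (e : rel Omega).

(** Entropy depends on a random variable only through the partition it induces, so variables are
    handled as equivalence relations on a finite sample space, and limits as membership in a
    pointwise closure; sequences are recovered at the end, where each stage has finite support.

    All stages live on one ground type [xground], which contains every future symbol from the start
    as a loop. Adding a point thus only redefines the function on the sets that contain this point.

    A new symbol t needs a point for every ordered pair of indices, because t_{ki} is the point of
    the inverse symbol on the line b_i b_k. These twelve points are constructed separately; only the
    plane arguments tie them together. Collinearity is carried as rank at most 2, since equality is
    automatic for points on two different sides of a triangle. *)

Definition mass p e w : R := \sum_(u | e w u) p u.

Definition relent p e : R := - \sum_w p w * ln (mass p e w).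

Lemma eqrel_refl e : equivalence_rel e -> reflexive e.
Proof. by move=> ee x; case: (ee x x x). Qed.

Lemma eqrel_eq e x y : equivalence_rel e -> e x y -> e x =1 e y.
Proof. by move=> ee exy z; case: (ee x y z) => _ ->. Qed.

Lemma eqrel_sym e x y : equivalence_rel e -> e x y = e y x.
Proof.
move=> ee; apply/idP/idP => h.
  by rewrite -(eqrel_eq ee h); exact: eqrel_refl.
by rewrite -(eqrel_eq ee h); exact: eqrel_refl.
Qed.

Lemma mass_eq p e x y : equivalence_rel e -> e x y -> mass p e x = mass p e y.
Proof. by move=> ee exy; apply: eq_bigl => u; exact: eqrel_eq. Qed.

Lemma mass_ge0 p e w : (forall w, 0 <= p w) -> 0 <= mass p e w.
Proof. by move=> p0; exact: sumr_ge0. Qed.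

Lemma mass_ge p e w : (forall w, 0 <= p w) -> reflexive e -> p w <= mass p e w.
Proof.
by move=> p0 re; rewrite /mass (bigD1 w)//= lerDl sumr_ge0.
Qed.

Lemma mass_gt0 p e w : (forall w, 0 <= p w) -> reflexive e -> p w != 0 ->
  0 < mass p e w.
Proof.
by move=> p0 re pw; apply: lt_le_trans (mass_ge _ p0 re); rewrite lt0r pw p0.
Qed.

Lemma mass_le p e e' w : (forall w, 0 <= p w) -> (forall u, e w u -> e' w u) ->
  mass p e w <= mass p e' w.
Proof.
move=> p0 ee'; rewrite /mass [leRHS](bigID (e w))/=.
rewrite [X in _ <= X + _](eq_bigl (e w)); last first.
  by move=> u; apply: andb_idl; exact: ee'.
by rewrite lerDl sumr_ge0.
Qed.

Lemma relentE p e : relent p e = \sum_w p w * - ln (mass p e w).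
Proof. by rewrite /relent -sumrN; apply: eq_bigr => w _; rewrite mulrN. Qed.

Lemma relent_total p e : \sum_w p w = 1 -> (forall w u, e w u) ->
  relent p e = 0.
Proof.
move=> p1 et; rewrite /relent big1 ?oppr0// => w _.
rewrite (_ : mass p e w = 1) ?ln1 ?mulr0//.
by rewrite /mass (eq_bigl xpredT)// => u; rewrite et.
Qed.

(** Points of probability zero enter neither the sum nor any mass. The relations compared on the
    space of two copies agree only on its support. *)
Lemma relent_supp p e e' :
  (forall w u, p w != 0 -> p u != 0 -> e w u = e' w u) ->
  relent p e = relent p e'.
Proof.
move=> ee'; rewrite !relentE; apply: eq_bigr => w _.
have [->|pw] := eqVneq (p w) 0; first by rewrite !mul0r.
suff -> : mass p e w = mass p e' w by [].
rewrite /mass (bigID (fun u => p u == 0))/= big1 ?add0r; last first.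
  by move=> u /andP[_ /eqP].
rewrite [RHS](bigID (fun u => p u == 0))/= [in RHS]big1 ?add0r; last first.
  by move=> u /andP[_ /eqP].
apply: eq_bigl => u; have [|pu] := eqVneq (p u) 0; first by rewrite !andbF.
by rewrite ee'.
Qed.

Lemma relent_le p e e' : (forall w, 0 <= p w) -> reflexive e ->
  (forall w u, e w u -> e' w u) -> relent p e' <= relent p e.
Proof.
move=> p0 re ee'; rewrite !relentE; apply: ler_sum => w _.
have [->|pw] := eqVneq (p w) 0; first by rewrite !mul0r.
apply: ler_wpM2l => //; rewrite lerN2.
have re' : reflexive e' by move=> x; apply: ee'; exact: re.
rewrite ler_ln ?posrE ?mass_gt0//; apply: mass_le => // u; exact: ee'.
Qed.

Lemma ln_le_subr1 (x : R) : 0 < x -> ln x <= x - 1.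
Proof.
move=> x0; have -> : ln x = ln (1 + (x - 1)) by congr ln; ring.
by apply: le_ln1Dx; lra.
Qed.

(** All points of [P] lie in one class, so the denominators coincide and are at least the mass of
    [P]. In a null class the quotients are zero by convention. *)
Lemma sum_class_le1 p e : (forall w, 0 <= p w) -> equivalence_rel e ->
  forall P : pred Omega, (forall w u, P w -> P u -> e w u) ->
  \sum_(w | P w) p w / mass p e w <= 1.
Proof.
move=> p0 ee P Pe; have [w0 Pw0|P0] := pickP P; last first.
  by rewrite big_pred0 ?ler01//.
rewrite (eq_bigr (fun w => p w / mass p e w0)); last first.
  by move=> w Pw; rewrite (mass_eq _ ee (Pe _ _ Pw Pw0)).
rewrite -mulr_suml; have [->|m0] := eqVneq (mass p e w0) 0.
  by rewrite invr0 mulr0 ler01.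
have mgt0 : 0 < mass p e w0 by rewrite lt0r m0 mass_ge0.
rewrite ler_pdivrMr// mul1r /mass [leRHS](bigID P)/=.
rewrite [X in _ <= X + _](eq_bigl P); last first.
  by move=> u; apply: andb_idl => Pu; exact: Pe.
by rewrite lerDl sumr_ge0.
Qed.

(** Nonnegativity of conditional mutual information, by [ln q <= q - 1]. [eC] is any coarser
    relation, as the kernel of an intersection may be strictly coarser than the join of the two
    kernels. *)
Lemma relent_submod p eA eB eC : is_distribution p ->
  equivalence_rel eA -> equivalence_rel eB -> equivalence_rel eC ->
  (forall w u, eA w u -> eC w u) -> (forall w u, eB w u -> eC w u) ->
  relent p (fun w u => eA w u && eB w u) + relent p eC <=
  relent p eA + relent p eB.
Proof.
move=> [p0 p1] hA hB hC AC BC; set eD := (fun w u => _).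
have hD : equivalence_rel eD.
  move=> x y z; rewrite /eD !eqrel_refl//; split=> // /andP[xy yz].
  by rewrite (eqrel_eq hA xy) (eqrel_eq hB yz).
have rA := eqrel_refl hA; have rB := eqrel_refl hB.
have rC := eqrel_refl hC; have rD := eqrel_refl hD.
rewrite !relentE -subr_ge0 -!big_split/= -sumrB.
(* The ratio of the mass a class would have if [eA] and [eB] were conditionally independent given
   [eC] to its true mass. Its mean may fall below 1, because the independent law may charge empty
   classes. *)
pose q w := mass p eA w * mass p eB w / (mass p eD w * mass p eC w).
have key : \sum_w p w * q w <= 1.
  have -> : \sum_w p w * q w = \sum_u \sum_v p u * (p v *
      \sum_(w | eA w u && eB w v) p w / (mass p eD w * mass p eC w)).
    (* Both masses in the numerator are expanded. For fixed [u] and [v] the remaining [w] lie in one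
       class of [eD], and there are none unless [eC u v]. *)
    transitivity (\sum_w \sum_(u | eA w u) \sum_(v | eB w v)
       p u * p v * (p w / (mass p eD w * mass p eC w))).
      apply: eq_bigr => w _; rewrite /q.
      under eq_bigr do rewrite -mulr_suml -mulr_sumr.
      rewrite -mulr_suml -mulr_suml -/(mass p eA w) -/(mass p eB w).
      by rewrite mulrCA.
    rewrite (exchange_big_dep xpredT)//=; apply: eq_bigr => u _.
    rewrite (exchange_big_dep xpredT)//=; apply: eq_bigr => v _.
    by rewrite mulrA mulr_sumr.
  have -> : 1 = \sum_u p u by rewrite p1.
  apply: ler_sum => u _.
  have [->|pu] := eqVneq (p u) 0.
    by rewrite big1// => v _; rewrite mul0r.
  rewrite -mulr_sumr -[leRHS]mulr1 ler_wpM2l//.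
  have mu : 0 < mass p eC u by rewrite mass_gt0.
  apply: (@le_trans _ _ (\sum_(v | eC u v) p v / mass p eC u)); last first.
    by rewrite -mulr_suml divff// gt_eqF.
  rewrite [leRHS]big_mkcond/=; apply: ler_sum => v _.
  have cls : \sum_(w | eA w u && eB w v) p w / mass p eD w <= 1.
    apply: sum_class_le1 => // x y /andP[xu xv] /andP[yu yv].
    rewrite /eD (eqrel_eq hA xu) (eqrel_eq hB xv).
    by rewrite (eqrel_sym _ _ hA) yu (eqrel_sym _ _ hB) yv.
  case: ifPn => [uv|uv].
    rewrite ler_wpM2l//.
    rewrite (eq_bigr (fun w => p w / mass p eD w * (mass p eC u)^-1)).
      by rewrite -mulr_suml ler_piMl// invr_ge0 ltW.
    move=> w /andP[/AC wu _].
    by rewrite (mass_eq _ hC wu) invfM mulrA.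
  rewrite big_pred0 ?mulr0// => w; apply: contraNF uv => /andP[/AC wu /BC wv].
  by rewrite -(eqrel_eq hC wu).
apply: (@le_trans _ _ (\sum_w (p w - p w * q w))).
  by rewrite sumrB p1 subr_ge0.
apply: ler_sum => w _; rewrite -!mulrDr.
have [->|pw] := eqVneq (p w) 0; first by rewrite !mul0r subr0.
have mA := mass_gt0 p0 rA pw; have mB := mass_gt0 p0 rB pw.
have mC := mass_gt0 p0 rC pw; have mD := mass_gt0 p0 rD pw.
rewrite -mulrBr -{1}[p w]mulr1 -mulrBr ler_wpM2l//.
have q0 : 0 < q w by rewrite /q divr_gt0// mulr_gt0.
have := ln_le_subr1 q0; rewrite {1}/q ln_div ?posrE ?mulr_gt0//.
by rewrite !lnM ?posrE//; lra.
Qed.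

End RelationEntropy.

(** * Entropic and almost entropic set functions *)

Section Entropic.
Variable R : realType.

(* [K i] is the kernel of the [i]-th random variable; the entropy depends on
   the variables only through their kernels. *)
Definition jker (E : Type) (Omega : finType) (K : E -> rel Omega) (A : set E) :
    rel Omega :=
  fun w u => `[< forall i, A i -> K i w u >].

Definition ent (E : Type) (f : set E -> R) : Prop :=
  exists (Omega : finType) (p : Omega -> R) (K : E -> rel Omega),
    [/\ is_distribution p, forall i, equivalence_rel (K i)
      & forall A, f A = relent p (jker K A)].

(* The closure of the entropic functions in the product topology. *)
Definition aent (E : Type) (f : set E -> R) : Prop :=
  forall (l : seq (set E)) (eps : R), 0 < eps ->
  exists2 h, ent h & forall A, A \in l -> `|h A - f A| < eps.

Record polym (E : Type) (f : set E -> R) : Prop := Polym {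
  polym0 : f set0 = 0;
  polym_mono : forall A B, A `<=` B -> f A <= f B;
  polym_submod : forall A B, f (A `|` B) + f (A `&` B) <= f A + f B }.

Section Kernels.
Variables (E : Type) (Omega : finType) (K : E -> rel Omega).
Hypothesis KE : forall i, equivalence_rel (K i).

Lemma jker_eqrel A : equivalence_rel (jker K A).
Proof.
move=> x y z; split; first by apply/asboolP => i _; exact: eqrel_refl.
move=> /asboolP xy; apply/asboolP/asboolP => h i Ai.
  by rewrite -(eqrel_eq (KE i) (xy _ Ai)) h.
by rewrite (eqrel_eq (KE i) (xy _ Ai)) h.
Qed.

Lemma jkerU A B w u : jker K (A `|` B) w u = jker K A w u && jker K B w u.
Proof.
apply/asboolP/andP => [h|[/asboolP hA /asboolP hB] i [Ai|Bi]].
- by split; apply/asboolP => i ?; apply: h; [left|right].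
- exact: hA.
- exact: hB.
Qed.

Lemma jkerS A B w u : A `<=` B -> jker K B w u -> jker K A w u.
Proof. by move=> AB /asboolP h; apply/asboolP => i /AB; exact: h. Qed.

End Kernels.

Lemma ent_polym (E : Type) (f : set E -> R) : ent f -> polym f.
Proof.
move=> [W [p [K [dp KE fE]]]]; have [p0 p1] := dp; split.
- by rewrite fE relent_total// => w u; apply/asboolP.
- move=> A B AB; rewrite !fE; apply: relent_le => //.
    exact: eqrel_refl (jker_eqrel KE B).
  by move=> w u; exact: jkerS.
- move=> A B; rewrite !fE.
  have -> : jker K (A `|` B) = fun w u => jker K A w u && jker K B w u.
    by apply/funext => w; apply/funext => u; rewrite jkerU.
  by apply: relent_submod => //; try exact: jker_eqrel;
    move=> w u; apply: jkerS => x [].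
Qed.

(** The variable at [i] becomes the tuple of the variables in [phi i]. This covers restriction,
    renaming, and turning elements into loops by an empty [phi i]. *)
Lemma ent_comap (E E' : Type) (phi : E' -> set E) (f : set E -> R) :
  ent f -> ent (fun A => f (\bigcup_(i in A) phi i)).
Proof.
move=> [W [p [K [dp KE fE]]]].
exists W, p, (fun i => jker K (phi i)); split=> // [i|A].
  exact: jker_eqrel.
rewrite fE; congr relent; apply/funext => w; apply/funext => u.
apply/asboolP/asboolP => [h i Ai|h i [j Aj ij]].
  by apply/asboolP => j ij; apply: h; exists i.
by have /asboolP := h _ Aj; exact.
Qed.

Lemma ent_cst0 (E : Type) : ent (fun _ : set E => 0).
Proof.
exists unit, (fun=> 1), (fun _ _ _ => true); split=> //.
- by split=> [w|]; rewrite ?ler01// (big_pred1 tt)// => -[].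
- move=> A; rewrite relent_total//; first by rewrite (big_pred1 tt)// => -[].
  by move=> w u; apply/asboolP.
Qed.

Lemma ent_add (E : Type) (f g : set E -> R) :
  ent f -> ent g -> ent (fun A => f A + g A).
Proof.
move=> [W1 [p1 [K1 [[p10 p11] KE1 fE]]]] [W2 [p2 [K2 [[p20 p21] KE2 gE]]]].
pose K i (w u : W1 * W2) := K1 i w.1 u.1 && K2 i w.2 u.2.
exists (W1 * W2)%type, (fun w => p1 w.1 * p2 w.2), K.
have tot : \sum_w p1 w.1 * p2 w.2 = 1 :> R.
  rewrite -(pair_bigA _ (fun a b => p1 a * p2 b))/=.
  by under eq_bigr do rewrite -mulr_sumr p21 mulr1.
split.
- by split=> // w; rewrite mulr_ge0.
- move=> i x y z; rewrite /K; split=> [|/andP[xy yz]].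
    by rewrite (eqrel_refl (KE1 i)) (eqrel_refl (KE2 i)).
  by rewrite (eqrel_eq (KE1 i) xy) (eqrel_eq (KE2 i) yz).
move=> A; rewrite fE gE.
have jK w u : jker K A w u = jker K1 A w.1 u.1 && jker K2 A w.2 u.2.
  apply/asboolP/andP => [h|[/asboolP h1 /asboolP h2] i Ai].
    by split; apply/asboolP => i /h /andP[].
  by rewrite /K h1// h2.
have mE w : mass (fun w => p1 w.1 * p2 w.2) (jker K A) w =
    mass p1 (jker K1 A) w.1 * mass p2 (jker K2 A) w.2.
  rewrite /mass; under [LHS]eq_bigl do rewrite jK.
  rewrite -(pair_big (jker K1 A w.1) (jker K2 A w.2)
    (fun a b => p1 a * p2 b))/=.
  by under eq_bigr do rewrite -mulr_sumr; rewrite -mulr_suml.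
rewrite !relentE; under [RHS]eq_bigr do rewrite mE.
rewrite -(pair_bigA _ (fun a b => p1 a * p2 b *
  - ln (mass p1 (jker K1 A) a * mass p2 (jker K2 A) b)))/=.
transitivity (\sum_a \sum_b (p1 a * p2 b * - ln (mass p1 (jker K1 A) a) +
    p1 a * p2 b * - ln (mass p2 (jker K2 A) b))).
  under [RHS]eq_bigr do rewrite big_split/=.
  rewrite big_split/=; congr (_ + _).
    apply: eq_bigr => a _; rewrite -mulr_suml -mulr_sumr p21 mulr1//.
  rewrite exchange_big/=; apply: eq_bigr => b _.
  by under [RHS]eq_bigr do rewrite -mulrA; rewrite -mulr_suml p11 mul1r.
apply: eq_bigr => a _; apply: eq_bigr => b _.
have [->|pa] := eqVneq (p1 a) 0; first by rewrite !mul0r addr0.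
have [->|pb] := eqVneq (p2 b) 0; first by rewrite !mulr0 !mul0r addr0.
rewrite -mulrDr lnM ?opprD// posrE mass_gt0//;
  by apply: eqrel_refl; exact: jker_eqrel.
Qed.

Lemma ent_muln (E : Type) (f : set E -> R) k :
  ent f -> ent (fun A => k%:R * f A).
Proof.
move=> ef; elim: k => [|k IH].
  by under eq_fun do rewrite mul0r; exact: ent_cst0.
under eq_fun do rewrite -natr1 mulrDl mul1r.
exact: ent_add.
Qed.

(** Entropy, in nats, of a bit that is 1 with probability [d]. *)
Definition bent (d : R) : R := - (d * ln d) - (1 - d) * ln (1 - d).

Lemma bent_small (eps : R) : 0 < eps ->
  exists2 d0, 0 < d0 & forall d, 0 < d -> d <= d0 -> d < 1 /\ `|bent d| < eps.
Proof.
move=> e0; exists (Num.min (1/2) ((eps / 4) ^+ 2)).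
  by rewrite lt_min exprn_gt0 ?divr_gt0//=; lra.
move=> d d0; rewrite le_min => /andP[d1 d2]; split; first lra.
have n1 : 0 <= - (d * ln d).
  by rewrite oppr_ge0 mulr_ge0_le0 ?(ltW d0)// ?ln_le0//; lra.
have n2 : 0 <= - ((1 - d) * ln (1 - d)).
  by rewrite oppr_ge0 mulr_ge0_le0 ?ln_le0//; lra.
rewrite ger0_norm /bent; last by lra.
pose s := Num.sqrt d.
have s0 : 0 < s by rewrite sqrtr_gt0.
have ss : d = s ^+ 2 by rewrite sqr_sqrtr// ltW.
have se : s <= eps / 4.
  by rewrite -(@ler_pXn2r _ 2)// ?nnegrE -?ss ?(ltW s0)//; lra.
have l1 : - (d * ln d) <= 2 * s.
  have := @ln_le_subr1 R s^-1; rewrite invr_gt0 s0 => /(_ isT).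
  rewrite lnV ?posrE// => h.
  rewrite {1 2}ss lnXn//.
  have -> : - (s ^+ 2 * (ln s *+ 2)) = 2 * (s * (s * - ln s)) by ring.
  rewrite ler_pM2l// -[leRHS]mulr1 ler_pM2l//.
  apply: (@le_trans _ _ (s * (s^-1 - 1))); first by rewrite ler_pM2l.
  by rewrite mulrBr mulfV ?gt_eqF//; lra.
have l2 : - ((1 - d) * ln (1 - d)) <= d.
  have := @ln_le_subr1 R (1 - d)^-1; rewrite invr_gt0 subr_gt0.
  have h1 : d < 1 by lra.
  rewrite h1 => /(_ isT); rewrite lnV ?posrE ?subr_gt0// => h.
  rewrite -mulrN; apply: (@le_trans _ _ ((1 - d) * ((1 - d)^-1 - 1))).
    by rewrite ler_pM2l// subr_gt0.
  by rewrite mulrBr mulfV ?gt_eqF// ?subr_gt0//; lra.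
have ds : d <= s.
  rewrite -[leRHS]mulr1 ss expr2 ler_pM2l//.
  by rewrite -(@ler_pXn2r _ 2)// ?nnegrE -?ss ?(ltW s0)//; lra.
lra.
Qed.

(** With probability [1 - d] the sample is replaced by an extra point that every variable
    recognises. This adds [bent d] to [d * f A] for nonempty [A] and nothing for the empty set,
    whence a bound and not an equality. *)
Lemma ent_thin (E : Type) (f : set E -> R) (d : R) : 0 < d -> d < 1 -> ent f ->
  exists2 h, ent h & forall A, `|h A - d * f A| <= `|bent d|.
Proof.
move=> d0 d1 [W [p [K [[p0 p1] KE fE]]]].
pose q (w : option W) : R := if w is Some w then d * p w else 1 - d.
pose K' i (w u : option W) :=
  match w, u with
  | Some w, Some u => K i w u | None, None => true | _, _ => false
  end.
have KE' i : equivalence_rel (K' i).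
  move=> [x|] [y|] [z|]; split => //=; try exact: eqrel_refl.
  by move=> xy; rewrite (eqrel_eq (KE i) xy).
have sumo (F : option W -> R) : \sum_w F w = F None + \sum_w F (Some w).
  rewrite (bigD1 None)//=; congr (_ + _).
  rewrite (reindex_omap Some id)//=; last by case.
  by apply: eq_bigl => x; rewrite eqxx.
have q1 : \sum_w q w = 1 by rewrite sumo/= -mulr_sumr p1; lra.
have q0 w : 0 <= q w by case: w => [w|] /=; [rewrite mulr_ge0// ltW|lra].
exists (fun A => relent q (jker K' A)); first by exists _, q, K'.
move=> A; rewrite fE; have [->|/set0P[i Ai]] := eqVneq A set0.
  by rewrite !relent_total ?mulr0 ?subr0 ?normr0// => w u; apply/asboolP.
suff -> : relent q (jker K' A) = d * relent p (jker K A) + bent d.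
  by rewrite addrAC subrr add0r.
have mS w : mass q (jker K' A) (Some w) = d * mass p (jker K A) w.
  rewrite /mass big_mkcond sumo/= ifF ?add0r; last first.
    by apply/asboolP => /(_ _ Ai).
  rewrite mulr_sumr [RHS]big_mkcond; apply: eq_bigr => u _.
  by congr (if _ then _ else _); apply/asboolP/asboolP.
have mN : mass q (jker K' A) None = 1 - d.
  rewrite /mass big_mkcond sumo/= ifT; last by apply/asboolP.
  by rewrite big1 ?addr0// => u _; rewrite ifF//; apply/asboolP => /(_ _ Ai).
rewrite !relentE sumo/= mN.
under eq_bigr do rewrite mS.
have -> : \sum_w d * p w * - ln (d * mass p (jker K A) w) =
  \sum_w (d * (p w * - ln (mass p (jker K A) w)) + p w * - (d * ln d)).
  apply: eq_bigr => w _; have [->|pw] := eqVneq (p w) 0.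
    by rewrite mulr0 !mul0r mulr0 addr0.
  rewrite lnM ?posrE//; last first.
    by rewrite mass_gt0//; apply: eqrel_refl; exact: jker_eqrel.
  by ring.
by rewrite big_split/= -mulr_sumr -mulr_suml p1 /bent; ring.
Qed.

Lemma ent_aent (E : Type) (f : set E -> R) : ent f -> aent f.
Proof. by move=> ef l e e0; exists f => // A _; rewrite subrr normr0. Qed.

Lemma aent_closed (E : Type) (f : set E -> R) :
  (forall (l : seq (set E)) (eps : R), 0 < eps ->
    exists2 g, aent g & forall A, A \in l -> `|g A - f A| < eps) -> aent f.
Proof.
move=> H l e e0; have e2 : 0 < e / 2 by lra.
have [g ag gf] := H l _ e2; have [h eh hg] := ag l _ e2.
exists h => // A Al; have := gf _ Al; have := hg _ Al.
by have := ler_distD (g A) (h A) (f A); lra.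
Qed.

Lemma aent_comap (E E' : Type) (phi : E' -> set E) (f : set E -> R) :
  aent f -> aent (fun A => f (\bigcup_(i in A) phi i)).
Proof.
move=> af l e e0.
have [h eh hf] := af [seq \bigcup_(i in A) phi i | A <- l] _ e0.
exists (fun A => h (\bigcup_(i in A) phi i)); first exact: ent_comap.
by move=> A Al; apply: hf; exact: map_f.
Qed.

Lemma aent_add (E : Type) (f g : set E -> R) :
  aent f -> aent g -> aent (fun A => f A + g A).
Proof.
move=> af ag l e e0; have e2 : 0 < e / 2 by lra.
have [f' ef ff] := af l _ e2; have [g' eg gg] := ag l _ e2.
exists (fun A => f' A + g' A); first exact: ent_add.
move=> A Al; have := ff _ Al; have := gg _ Al.
rewrite opprD addrACA; have := ler_normD (f' A - f A) (g' A - g A); lra.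
Qed.

Lemma aent_sum (E : Type) (I : finType) (F : I -> set E -> R) :
  (forall i, aent (F i)) -> aent (fun A => \sum_i F i A).
Proof.
move=> aF; suff H (s : seq I) : aent (fun A => \sum_(i <- s) F i A) by exact: H.
elim: s => [|i s IH].
  by under eq_fun do rewrite big_nil; apply: ent_aent; exact: ent_cst0.
by under eq_fun do rewrite big_cons; exact: aent_add.
Qed.

(* With [d = c / k] small, a [d]-thinning of [k] independent copies has entropy
   [c * f] up to the entropy of the thinning bit. *)
Lemma aent_scale (E : Type) (f : set E -> R) c :
  0 <= c -> aent f -> aent (fun A => c * f A).
Proof.
rewrite le_eqVlt => /predU1P[<- _|c0 af].
  by under eq_fun do rewrite mul0r; apply: ent_aent; exact: ent_cst0.
move=> l e e0; have e2 : 0 < e / 2 by lra.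
have [d0 d0_gt0 bd] := bent_small e2.
have e3 : 0 < e / 2 / c by rewrite divr_gt0.
have [h eh hf] := af l _ e3.
have [k kd] : exists k : nat, c / k.+1%:R <= d0.
  exists (Num.truncn (c / d0)).
  rewrite ler_pdivrMr// mulrC -ler_pdivrMr//; apply: ltW.
  by apply: truncnS_gt.
have d_gt0 : 0 < c / k.+1%:R by rewrite divr_gt0.
have [d1 bde] := bd _ d_gt0 kd.
have [g eg gh] := ent_thin d_gt0 d1 (ent_muln k.+1 eh).
exists g => // A Al; have := gh A; rewrite mulrA divfK ?pnatr_eq0// => gA.
have := hf _ Al; rewrite ltr_pdivlMr// mulrC -{1}(gtr0_norm c0) -normrM mulrBr.
by have := ler_distD (c * h A) (g A) (c * f A); lra.
Qed.

Lemma aent_polym (E : Type) (f : set E -> R) : aent f -> polym f.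
Proof.
move=> af; split.
- apply/eqP; rewrite -normr_eq0; apply/eqP/le_anti; rewrite normr_ge0 andbT.
  apply/ler_addgt0Pr => e e0; rewrite add0r.
  have [h /ent_polym[h0 _ _] /(_ set0)] := af [:: set0] _ e0.
  by rewrite inE h0 sub0r normrN => /(_ (eqxx _))/ltW.
- move=> A B AB; apply/ler_addgt0Pr => e e0.
  have e2 : 0 < e / 2 by lra.
  have [h /ent_polym[_ /(_ _ _ AB) hm _] hf] := af [:: A; B] _ e2.
  have := hf A; rewrite !inE eqxx => /(_ isT); rewrite ltr_norml => /andP[].
  have := hf B; rewrite !inE eqxx orbT => /(_ isT); rewrite ltr_norml => /andP[].
  by lra.
- move=> A B; apply/ler_addgt0Pr => e e0.
  have e4 : 0 < e / 4 by lra.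
  have [h /ent_polym[_ _ /(_ A B) hm] hf] :=
    af [:: A; B; A `|` B; A `&` B] _ e4.
  have := hf A; rewrite !inE eqxx => /(_ isT); rewrite ltr_norml => /andP[].
  have := hf B; rewrite !inE eqxx orbT => /(_ isT); rewrite ltr_norml => /andP[].
  have := hf (A `|` B).
  rewrite !inE eqxx !orbT => /(_ isT); rewrite ltr_norml => /andP[].
  have := hf (A `&` B).
  rewrite !inE eqxx !orbT => /(_ isT); rewrite ltr_norml => /andP[].
  by lra.
Qed.

Lemma polym_ge0 (E : Type) (f : set E -> R) A : polym f -> 0 <= f A.
Proof. by move=> pf; rewrite -(polym0 pf); apply: polym_mono. Qed.

Lemma polym_subadd (E : Type) (f : set E -> R) A B : polym f ->
  f (A `|` B) <= f A + f B.
Proof.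
by move=> pf; have := polym_submod pf A B; have := polym_ge0 (A `&` B) pf; lra.
Qed.

(* Conditioning on the variables in [C] averages the entropy functions of the
   conditional distributions. *)
Lemma ent_contract (E : Type) (f : set E -> R) (C : set E) :
  ent f -> aent (fun A => f (A `|` C) - f C).
Proof.
move=> [W [p [K [[p0 p1] KE fE]]]].
have hC := jker_eqrel KE C; have rC := eqrel_refl hC.
pose m w := mass p (jker K C) w.
pose pc w u := if jker K C w u then p u / m w else 0.
(* The average over classes of [jker K C], written over sample points: a class is counted once for
   each of its points, with total weight its mass. *)
pose F w A := p w * relent (pc w) (jker K A).
have aF w : aent (F w).
  have [pw|pw] := eqVneq (p w) 0.
    rewrite /F pw; under eq_fun do rewrite mul0r.
    by apply: ent_aent; exact: ent_cst0.
  apply: aent_scale => //; apply: ent_aent; exists W, (pc w), K; split=> //.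
  have mw : 0 < m w by rewrite /m mass_gt0.
  split=> [u|]; first by rewrite /pc; case: ifP => // _; rewrite divr_ge0// ltW.
  rewrite /pc -big_mkcond/= -mulr_suml -/(mass _ _ _) divff// gt_eqF//.
suff -> : (fun A => f (A `|` C) - f C) = fun A => \sum_w F w A by exact: aent_sum.
apply/funext => A.
have hAC := jker_eqrel KE (A `|` C); have rAC := eqrel_refl hAC.
pose D u := - ln (mass p (jker K (A `|` C)) u) + ln (m u).
have FE w : F w A = \sum_(u | jker K C w u) p u * D u * (p w / m u).
  rewrite /F; have [->|pw] := eqVneq (p w) 0.
    by rewrite mul0r big1// => u _; rewrite mul0r mulr0.
  have mw : 0 < m w by rewrite /m mass_gt0.
  rewrite relentE mulr_sumr [RHS]big_mkcond/=; apply: eq_bigr => u _.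
  rewrite {1}/pc; case: ifP => wu; last by rewrite mul0r mulr0.
  have [->|pu] := eqVneq (p u) 0; first by rewrite !mul0r mulr0.
  have muw : m u = m w by apply/esym/mass_eq.
  rewrite muw /D muw.
  have -> : mass (pc w) (jker K A) u = mass p (jker K (A `|` C)) u / m w.
    rewrite /mass mulr_suml big_mkcond [RHS]big_mkcond/=; apply: eq_bigr => v _.
    rewrite jkerU /pc (eqrel_eq hC wu); case: (jker K A u v) => //=.
  rewrite ln_div ?posrE ?mass_gt0//; ring.
under eq_bigr do rewrite FE.
rewrite (exchange_big_dep xpredT)//= !fE !relentE -sumrB.
apply: eq_bigr => u _; rewrite -mulrBr opprK -/(m u) -mulr_sumr -mulr_suml.
have [->|pu] := eqVneq (p u) 0; first by rewrite !mul0r.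
rewrite (eq_bigl (jker K C u)); last by move=> w; rewrite (eqrel_sym _ _ hC).
rewrite -/(mass _ _ _) -/(m u) divff ?mulr1//.
by rewrite gt_eqF// /m mass_gt0.
Qed.

Lemma aent_contract (E : Type) (f : set E -> R) (C : set E) :
  aent f -> aent (fun A => f (A `|` C) - f C).
Proof.
move=> af; apply: aent_closed => l e e0; have e2 : 0 < e / 2 by lra.
have [h eh hf] := af (C :: [seq A `|` C | A <- l]) _ e2.
exists (fun A => h (A `|` C) - h C); first exact: ent_contract.
move=> A Al; have := hf C; rewrite inE eqxx => /(_ isT).
have := hf (A `|` C).
rewrite inE (map_f (fun A => A `|` C) Al) orbT => /(_ isT).
rewrite !ltr_norml => /andP[h1 h2] /andP[h3 h4]; apply/andP; split; lra.
Qed.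

End Entropic.

(* Two copies of the sample space, conditionally independent given the
   variables in [F]. *)
Section Copy.
Variables (R : realType) (E : Type) (W : finType) (p : W -> R).
Variables (K : E -> rel W) (F : set E).
Hypotheses (dp : is_distribution p) (KE : forall i, equivalence_rel (K i)).

Let p0 : forall w, 0 <= p w := proj1 dp.
Let m := mass p (jker K F).
Let hF := jker_eqrel KE F.

Definition copy_dist (x : W * W) : R :=
  if jker K F x.1 x.2 then p x.1 * p x.2 / mass p (jker K F) x.1 else 0.

Definition copy_ker (i : E + E) (x y : W * W) : bool :=
  match i with inl i => K i x.1 y.1 | inr i => K i x.2 y.2 end.

Let q := copy_dist.

Let m_gt0 w : p w != 0 -> 0 < m w.
Proof. by move=> pw; rewrite /m mass_gt0//; exact: eqrel_refl. Qed.

Lemma copy_dist_neq0 x : q x != 0 ->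
  [/\ p x.1 != 0, p x.2 != 0 & jker K F x.1 x.2].
Proof.
rewrite /q /copy_dist; case: ifP => [hx|_]; last by rewrite eqxx.
by rewrite !mulf_eq0 => /norP[/norP[-> ->] _].
Qed.

Lemma copy_margl w : \sum_u q (w, u) = p w.
Proof.
have [pw|pw] := eqVneq (p w) 0.
  by rewrite big1// => u _; rewrite /q /copy_dist/= pw !mul0r if_same.
rewrite /q /copy_dist/= -big_mkcond/=.
rewrite (eq_bigr (fun u => p w / m w * p u)); last first.
  by move=> u _; rewrite -/(m w) mulrAC.
by rewrite -mulr_sumr -/(mass _ _ _) -/(m w) divfK// gt_eqF// m_gt0.
Qed.

Lemma copy_margr u : \sum_w q (w, u) = p u.
Proof.
have [pu|pu] := eqVneq (p u) 0.
  by rewrite big1// => w _; rewrite /q /copy_dist/= pu mulr0 mul0r if_same.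
rewrite /q /copy_dist/= -big_mkcond/=.
rewrite (eq_bigl (jker K F u)); last by move=> w; exact: eqrel_sym.
rewrite (eq_bigr (fun w => p u / m u * p w)); last first.
  move=> w uw; rewrite -/(m w) /m -(mass_eq _ hF uw) -/(m u); ring.
by rewrite -mulr_sumr -/(mass _ _ _) -/(m u) divfK// gt_eqF// m_gt0.
Qed.

Lemma copy_expl (G : W -> R) : \sum_x q x * G x.1 = \sum_w p w * G w.
Proof.
rewrite -(pair_bigA _ (fun a b => q (a, b) * G a))/=.
by apply: eq_bigr => w _; rewrite -mulr_suml copy_margl.
Qed.

Lemma copy_expr (G : W -> R) : \sum_x q x * G x.2 = \sum_w p w * G w.
Proof.
rewrite -(pair_bigA _ (fun a b => q (a, b) * G b))/= exchange_big/=.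
by apply: eq_bigr => w _; rewrite -mulr_suml copy_margr.
Qed.

Lemma copy_dist_distribution : is_distribution q.
Proof.
split=> [x|].
  rewrite /q /copy_dist; case: ifP => // _.
  by rewrite divr_ge0 ?mulr_ge0// mass_ge0.
have := copy_expl (fun=> 1); under eq_bigr do rewrite mulr1.
by move=> ->; under eq_bigr do rewrite mulr1; case: dp.
Qed.

Lemma copy_ker_eqrel i : equivalence_rel (copy_ker i).
Proof. by case: i => i x y z; exact: KE. Qed.

Lemma jker_copy A C x y : jker copy_ker ((inl @` A) `|` (inr @` C)) x y =
  jker K A x.1 y.1 && jker K C x.2 y.2.
Proof.
rewrite jkerU; congr (_ && _); apply/asboolP/asboolP => [h i Ai|h _ [i Ai <-]].
- by apply: (h (inl i)); exists i.
- exact: h.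
- by apply: (h (inr i)); exists i.
- exact: h.
Qed.

Lemma copy_relentl A :
  relent q (jker copy_ker (inl @` A)) = relent p (jker K A).
Proof.
rewrite -[X in jker _ X]setU0 -(image_set0 inr).
rewrite !relentE -(copy_expl (fun w => - ln (mass p (jker K A) w))).
apply: eq_bigr => x _; suff -> : mass q (jker copy_ker
  ((inl @` A) `|` (inr @` set0))) x = mass p (jker K A) x.1 by [].
rewrite /mass; under eq_bigl do rewrite jker_copy.
rewrite (eq_bigl (fun y => jker K A x.1 y.1 && true)); last first.
  by move=> y; congr (_ && _); apply/asboolP.
rewrite -(pair_big (jker K A x.1) xpredT (fun a b => q (a, b)))/=.
by apply: eq_bigr => w _; rewrite copy_margl.
Qed.

(** Almost surely both coordinates agree on the variables in [F], so the first copy of [A] may be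
    read off the second coordinate. *)
Lemma copy_relent_parallel A C : A `<=` F ->
  relent q (jker copy_ker ((inl @` A) `|` (inr @` C))) =
  relent p (jker K (A `|` C)).
Proof.
move=> AF; rewrite (@relent_supp _ _ _ _ (fun x y => jker K (A `|` C) x.2 y.2)).
  rewrite !relentE -(copy_expr (fun w => - ln (mass p (jker K (A `|` C)) w))).
  apply: eq_bigr => x _; suff -> : mass q (fun x y => jker K (A `|` C) x.2 y.2)
    x = mass p (jker K (A `|` C)) x.2 by [].
  rewrite /mass -(pair_big xpredT (jker K (A `|` C) x.2) (fun a b => q (a, b)))/=.
  by rewrite exchange_big/=; apply: eq_bigr => w _; rewrite copy_margr.
move=> x y /copy_dist_neq0[_ _ hx] /copy_dist_neq0[_ _ hy].
rewrite jker_copy jkerU; congr (_ && _).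
have hA := jker_eqrel KE A.
rewrite (eqrel_eq hA (jkerS AF hx)) (eqrel_sym _ _ hA).
by rewrite (eqrel_eq hA (jkerS AF hy)) (eqrel_sym _ _ hA).
Qed.

(** On the support, agreement on [A] entails agreement on [F] in both coordinates, so [F] may be
    added to [C]; the mass then factors by conditional independence given [F]. *)
Lemma copy_relent_indep A C : F `<=` A ->
  relent q (jker copy_ker ((inl @` A) `|` (inr @` C))) =
  relent p (jker K A) + relent p (jker K (C `|` F)) - relent p (jker K F).
Proof.
move=> FA; have hA := jker_eqrel KE A; have hC := jker_eqrel KE (C `|` F).
rewrite (@relent_supp _ _ _ _ (fun x y =>
  jker K A x.1 y.1 && jker K (C `|` F) x.2 y.2)); last first.
  move=> x y /copy_dist_neq0[_ _ hx] /copy_dist_neq0[_ _ hy].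
  rewrite jker_copy jkerU; case xy: (jker K A x.1 y.1) => //=.
  have -> : jker K F x.2 y.2; last by rewrite andbT.
  rewrite -(eqrel_eq hF hx) (eqrel_eq hF (jkerS FA xy)) //.
rewrite !relentE -(copy_expl (fun w => - ln (mass p (jker K A) w))).
rewrite -(copy_expr (fun w => - ln (mass p (jker K (C `|` F)) w))).
rewrite -(copy_expl (fun w => - ln (mass p (jker K F) w))).
rewrite -big_split -sumrB/=; apply: eq_bigr => x _.
have [->|qx] := eqVneq (q x) 0; first by rewrite !mul0r addr0 subr0.
have [p1 p2 hx] := copy_dist_neq0 qx.
have -> : mass q (fun x y => jker K A x.1 y.1 && jker K (C `|` F) x.2 y.2) x =
  mass p (jker K A) x.1 * mass p (jker K (C `|` F)) x.2 / m x.1.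
  rewrite /mass -(pair_big (jker K A x.1) (jker K (C `|` F) x.2)
    (fun a b => q (a, b)))/= mulr_suml mulr_suml; apply: eq_bigr => u xu.
  rewrite mulr_sumr mulr_suml; apply: eq_bigr => v xv.
  have xuF := jkerS FA xu.
  have xvF := jkerS (@subsetUr _ C F) xv.
  rewrite /q /copy_dist/= -(eqrel_eq hF xuF) (eqrel_eq hF hx) xvF.
  by rewrite /m (mass_eq _ hF xuF).
have mA : 0 < mass p (jker K A) x.1 by rewrite mass_gt0//; exact: eqrel_refl.
have mC : 0 < mass p (jker K (C `|` F)) x.2.
  by rewrite mass_gt0//; exact: eqrel_refl.
have mF := m_gt0 p1.
by rewrite ln_div ?posrE ?mulr_gt0// lnM ?posrE// -/(m x.1); ring.
Qed.

End Copy.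

(** * Almost entropic functions: copies by compactness, extension by points *)

Section AlmostEntropic.
Variable R : realType.

Lemma ent_copy (E : Type) (f : set E -> R) (F : set E) : ent f ->
  exists g : set (E + E) -> R, [/\ ent g,
    forall A, g (inl @` A) = f A,
    forall A C, A `<=` F -> g ((inl @` A) `|` (inr @` C)) = f (A `|` C) &
    forall A C, F `<=` A ->
      g ((inl @` A) `|` (inr @` C)) = f A + f (C `|` F) - f F].
Proof.
move=> [W [p [K [dp KE fE]]]].
exists (fun A => relent (copy_dist p K F) (jker (copy_ker K) A)); split.
- exists _, (copy_dist p K F), (copy_ker K); split=> //.
    exact: copy_dist_distribution.
  exact: copy_ker_eqrel.
- by move=> A; rewrite copy_relentl.
- by move=> A C AF; rewrite copy_relent_parallel.
- by move=> A C FA; rewrite copy_relent_indep// !fE.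
Qed.

(** Compactness of the segment gives a cluster point, and an ultrafilter converges to each of its
    cluster points. *)
Lemma ultra_bounded_cvg (I : Type) (G : set_system I) (f : I -> R) (a b : R) :
  UltraFilter G -> (\forall i \near G, a <= f i <= b) ->
  exists l : R, f @ G --> l.
Proof.
move=> UG Gab; have PG : ProperFilter (f @ G) by exact: fmap_proper_filter.
have [|l [_ fl]] := @segment_compact R a b (f @ G) PG.
  by near do rewrite /= in_itv/=.
exists l => N Nl; have [//|GN] := in_ultra_setVsetC (f @^-1` N) UG.
by have [x [nx /nx]] := fl (~` N) N GN Nl.
Unshelve. all: by end_near. Qed.

End AlmostEntropic.

Section Limits.
Variable R : realType.

Lemma filter_seq (I : Type) (T : eqType) (G : set_system I) (l : seq T)
    (P : T -> I -> Prop) : Filter G ->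
  (forall x, x \in l -> \forall i \near G, P x i) ->
  \forall i \near G, forall x, x \in l -> P x i.
Proof.
move=> FG; elim: l => [|x l IH] H; first by apply: nearW.
have Hx := H x (mem_head _ _).
have Hl : \forall i \near G, forall y, y \in l -> P y i.
  by apply: IH => y yl; apply: H; rewrite inE yl orbT.
near=> i => y; rewrite inE => /predU1P[->|]; first by near: i.
by move: y; near: i.
Unshelve. all: by end_near. Qed.

(** Every entropic [h] near [f] has a copy, but the chosen copies of nearby functions need not be
    close. Along an ultrafilter finer than the neighbourhoods of [f] all their values converge at
    once, and the three identities pass to the limit. *)
Lemma aent_copy (E : Type) (f : set E -> R) (F : set E) : aent f ->
  exists g : set (E + E) -> R, [/\ aent g,
    forall A, g (inl @` A) = f A,
    forall A C, A `<=` F -> g ((inl @` A) `|` (inr @` C)) = f (A `|` C) &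
    forall A C, F `<=` A ->
      g ((inl @` A) `|` (inr @` C)) = f A + f (C `|` F) - f F].
Proof.
move=> af.
pose B (le : seq (set E) * R) : set (set E -> R) :=
  [set h | ent h /\ forall A, A \in le.1 -> `|h A - f A| < le.2].
pose G0 := filter_from [set le : seq (set E) * R | 0 < le.2] B.
have FG0 : Filter G0.
  apply: filter_from_filter; first by exists ([::], 1) => /=.
  move=> [l1 e1] [l2 e2] /= h1 h2; exists (l1 ++ l2, Num.min e1 e2) => /=.
    by rewrite lt_min h1.
  move=> h [eh hf]; split; split=> //= A Al; have := hf A;
    by rewrite mem_cat Al ?orbT lt_min => /(_ isT)/andP[].
have PG0 : ProperFilter G0.
  by apply: filter_from_proper => -[l e] /= e0; have [h] := af l e e0; exists h.
have [U [UU GU]] := ultraFilterLemma PG0.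
have Uent : \forall h \near U, ent h.
  by apply: GU; exists ([::], 1) => //= h [].
have Ucvg A : (fun h : set E -> R => h A) @ U --> f A.
  apply/cvgrPdist_lt => e e0; apply: GU; exists ([:: A], e) => //= h [_].
  by move=> /(_ A); rewrite inE eqxx distrC; exact.
have /choice[c cP] : forall h, exists c : set (E + E) -> R, ent h ->
    [/\ ent c,
    forall A, c (inl @` A) = h A,
    forall A C, A `<=` F -> c ((inl @` A) `|` (inr @` C)) = h (A `|` C) &
    forall A C, F `<=` A ->
      c ((inl @` A) `|` (inr @` C)) = h A + h (C `|` F) - h F].
  move=> h; have [eh|neh] := pselect (ent h); last by exists (fun=> 0).
  by have [g gP] := ent_copy F eh; exists g.
have /choice[g gP] : forall X, exists l : R, c ^~ X @ U --> l.
  move=> X.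
  (* The whole of [E + E] has rank [2 * h setT - h F], and eventually [h setT < f setT + 1]. *)
  apply: (@ultra_bounded_cvg _ _ _ _ 0 (2 * (f setT + 1)) UU).
  have hT : \forall h \near U, `|h setT - f setT| < 1.
    by have /cvgrPdistC_lt := Ucvg setT; apply.
  near=> h.
  have eh : ent h by near: h.
  have : `|h setT - f setT| < 1 by near: h.
  rewrite ltr_norml => /andP[_ hT1].
  have [ech _ _ cI] := cP h eh; have pc := ent_polym ech.
  have ph := ent_polym eh.
  rewrite polym_ge0//=; have := polym_mono pc (@subsetT _ X).
  have -> : [set: E + E] = (inl @` setT) `|` (inr @` setT).
    by apply/seteqP; split=> // -[x|x] _; [left|right]; exists x.
  rewrite cI// setTU; have := polym_ge0 F ph; lra.
have gE X r : (\forall h \near U, c h X = r h) ->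
    forall l, r @ U --> l -> g X = l.
  move=> cr l rl; apply: (cvg_unique (@norm_hausdorff _ _) (gP X)).
  by apply: cvg_trans rl; apply: near_eq_cvg; near=> h; apply/esym; near: h.
exists g; split.
- apply: aent_closed => l e e0.
  have near_l : \forall h \near U, forall A, A \in l -> `|c h A - g A| < e.
    by apply: filter_seq => A _; have /cvgrPdistC_lt := gP A; apply.
  have [h [eh hl]] := filter_ex (filterI Uent near_l).
  by exists (c h) => //; apply: ent_aent; have [] := cP h eh.
- move=> A; apply: (gE _ (fun h => h A)) => //.
  by near=> h; have [|_ -> _ _ //] := cP h; near: h.
- move=> A C AF; apply: (gE _ (fun h => h (A `|` C))) => //.
  by near=> h; have [|_ _ -> //] := cP h; near: h.
- move=> A C FA; apply: (gE _ (fun h => h A + h (C `|` F) - h F)).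
    by near=> h; have [|_ _ _ -> //] := cP h; near: h.
  by apply: cvgB => //; apply: cvgD.
Unshelve. all: by end_near. Qed.

(* [c] and [x] are replaced by copies independent of everything else given [F];
   [c] being independent of [F], the copy of [c] is independent of the whole
   ground set and can be contracted without changing [f]. *)
Lemma aent_extend1 (E : Type) (f : set E -> R) (F : set E) (t c x : E) :
  aent f -> f (F `|` [set c]) = f F + f [set c] ->
  exists g, [/\ aent g, forall A, ~ A t -> g A = f A &
    forall A, A `<=` F -> ~ A t ->
      g (A `|` [set t]) = f (A `|` [set c; x]) - f [set c]].
Proof.
move=> af Fc; have [h [ah hl hp hi]] := aent_copy F af.
have ph := aent_polym ah; have pf := aent_polym af.
have hc : h (inr @` [set c]) = f [set c].
  by have := hp set0 [set c] (@sub0set _ F); rewrite image_set0 !set0U.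
(* [t] is sent to the second copy of [x], every other element to its own first copy. *)
pose phi (y : E) : set (E + E) :=
  [set z | (y <> t /\ z = inl y) \/ (y = t /\ z = inr x)].
exists (fun A => h ((\bigcup_(i in A) phi i) `|` (inr @` [set c])) -
  h (inr @` [set c])).
have bigl A : ~ A t -> \bigcup_(i in A) phi i = inl @` A.
  move=> At; apply/seteqP; split=> [z [i Ai] [[_ ->]|[it _]]|z [i Ai <-]].
  - by exists i.
  - by rewrite -it in At.
  - by exists i => //; left; split=> // it; rewrite it in Ai.
split.
- exact: (@aent_comap _ _ _ phi _ (aent_contract (inr @` [set c]) ah)).
- move=> A At; rewrite bigl// hc.
  (* [hi] speaks only of sets containing [F]. It gives independence of the copy of [c] from the
     union of [A] and [F], and submodularity brings this down to [A]. *)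
  have FA : F `<=` A `|` F by [].
  have h1 := hi (A `|` F) [set c] FA.
  have h2 := polym_subadd (inl @` A) (inr @` [set c]) ph.
  have h3 := polym_submod ph ((inl @` A) `|` (inr @` [set c]))
    (inl @` (A `|` F)).
  have h4 : h (inl @` A) <= h (((inl @` A) `|` (inr @` [set c])) `&`
      (inl @` (A `|` F))).
    by apply: (polym_mono ph) => z [y Ay <-]; split; [left|]; exists y => //; left.
  have h5 : h ((inl @` (A `|` F)) `|` (inr @` [set c])) <=
      h (((inl @` A) `|` (inr @` [set c])) `|` (inl @` (A `|` F))).
    by apply: (polym_mono ph) => z [zl|zr]; [right|left; right].
  move: h1 h2 h3 h4 h5; rewrite [[set c] `|` F]setUC Fc !hl hc; lra.
- move=> A AF At; rewrite bigcup_setU bigl// bigcup_set1 hc.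
  have -> : phi t = [set inr x].
    by apply/seteqP; split=> [z [[/(_ erefl)]|[_ ->]]//|z ->]; right.
  rewrite -setUA; have -> : [set inr x] `|` (inr @` [set c]) =
      inr @` [set c; x] :> set (E + E).
    by rewrite image_setU !image_set1 setUC.
  by rewrite hp.
Qed.

End Limits.

(** Each step reads its data on subsets of [old], which no step alters, so all formulas refer to the
    original [f] although the points are added one after another. *)
Lemma aent_extend_seq (R : realType) (E : Type) (T : eqType) (f : set E -> R)
    (old : set E) (F : T -> set E) (t c x : T -> E) (s : seq T) :
  aent f -> uniq s -> {in s &, injective t} ->
  (forall i, i \in s -> [/\ F i `<=` old, old (c i), old (x i) & ~ old (t i)]) ->
  (forall i, i \in s -> f (F i `|` [set c i]) = f (F i) + f [set c i]) ->
  exists g, [/\ aent g,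
    forall A, (forall i, i \in s -> ~ A (t i)) -> g A = f A &
    forall i A, i \in s -> A `<=` F i ->
      g (A `|` [set t i]) = f (A `|` [set c i; x i]) - f [set c i]].
Proof.
move=> af; elim: s => [|i s IH] /=; first by exists f.
move=> /andP[iNs us] tinj Hold Hind.
have memS j : j \in s -> j \in i :: s by move=> js; rewrite inE js orbT.
have [|||g [ag gf gt]] := IH us.
- by move=> j k /memS js /memS; exact: tinj.
- by move=> j /memS; exact: Hold.
- by move=> j /memS; exact: Hind.
have [Fi ci xi ti] := Hold _ (mem_head i s).
have gold A : A `<=` old -> g A = f A.
  move=> Ao; apply: gf => j /memS js /Ao otj.
  by have [_ _ _ /(_ otj)] := Hold _ js.
have cold : [set c i] `<=` old by move=> _ ->.
have xold : [set x i] `<=` old by move=> _ ->.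
have Fcold : F i `|` [set c i] `<=` old by move=> z [/Fi|/cold].
have [|h [ah hg ht]] := @aent_extend1 _ _ g (F i) (t i) (c i) (x i) ag.
  by rewrite !gold//; apply: Hind; rewrite mem_head.
exists h; split=> //.
- move=> A At; rewrite hg; last by apply: At; rewrite mem_head.
  by apply: gf => j /memS; exact: At.
- move=> j A; rewrite inE => /predU1P[->|js] AF.
    rewrite ht//; last by move=> /AF/Fi.
    by rewrite !gold// => z [/AF/Fi|[/cold|/xold]].
  have [Fj cj xj tj] := Hold _ (memS _ js).
  rewrite hg; first exact: gt.
  move=> [/AF/Fj//|/= /tinj ij].
  by move: iNs; rewrite ij ?js// ?mem_head// memS.
Qed.

(** * Points, lines and planes in rank four *)

Ltac incl := solve [move=> /=; tauto | move=> ? /=; tauto].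

Lemma uniq3E (T : eqType) (i j k : T) :
  uniq [:: i; j; k] = [&& i != j, i != k & j != k].
Proof. by rewrite /= !inE !negb_or andbT andbA. Qed.

Lemma uniq4E (T : eqType) (i j k l : T) : uniq [:: i; j; k; l] =
  [&& i != j, i != k, i != l, j != k, j != l & k != l].
Proof. by rewrite /= !inE !negb_or andbT -!andbA. Qed.

Section FourIndices.
Variables (T : eqType) (i j k l : T).
Hypothesis u : uniq [:: i; j; k; l].

Let u' : [/\ i != j, i != k, i != l & [/\ j != k, j != l & k != l]].
Proof. by move: u; rewrite uniq4E => /and5P[-> -> -> -> /andP[-> ->]]. Qed.

Lemma uniq4_ijk : uniq [:: i; j; k].
Proof. by case: u' => ij ik _ [jk _ _]; rewrite uniq3E ij ik jk. Qed.

Lemma uniq4_ilj : uniq [:: i; l; j].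
Proof. by case: u' => ij _ il [_ jl _]; rewrite uniq3E il ij eq_sym jl. Qed.

Lemma uniq4_ilk : uniq [:: i; l; k].
Proof. by case: u' => _ ik il [_ _ kl]; rewrite uniq3E il ik eq_sym kl. Qed.

Lemma uniq4_klj : uniq [:: k; l; j].
Proof.
case: u' => _ _ _ [jk jl kl].
by rewrite uniq3E kl (eq_sym k j) jk (eq_sym l j) jl.
Qed.

End FourIndices.

Section Geometry.
Variables (R : realType) (E : Type).
Implicit Types (f : set E -> R) (b : 'I_4 -> E).

Record frame f b : Prop := Frame {
  frame_polym : polym f;
  frame1 : forall i, f [set b i] = 1;
  frame3 : forall i j k, uniq [:: i; j; k] -> f [set b i; b j; b k] = 3;
  frame4 : forall i j k l, uniq [:: i; j; k; l] ->
    f [set b i; b j; b k; b l] = 4 }.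

Record online f b (i j : 'I_4) (a : E) : Prop := Online {
  online_pt : f [set a] = 1;
  online_l : f [set b i; a] = 2;
  online_r : f [set b j; a] = 2;
  online_b : f [set b i; b j] = 2;
  online_lr : f [set b i; b j; a] = 2 }.

Lemma onlineC f b i j a : online f b i j a -> online f b j i a.
Proof.
case=> h1 h2 h3 h4 h5; split=> //; first by rewrite setUC.
by rewrite -h5; congr f; apply/seteqP; split; incl.
Qed.

(** Submodularity with union and intersection replaced by sets merely contained in them, so that
    applications need inclusions and no set equations. *)
Lemma polym_meet f X Y P Q : polym f -> P `<=` X `|` Y -> Q `<=` X ->
  Q `<=` Y -> f P + f Q <= f X + f Y.
Proof.
move=> pf PXY QX QY; have h1 := polym_mono pf PXY.
have h2 : f Q <= f (X `&` Y).
  by apply: (polym_mono pf) => z Qz; split; [exact: QX|exact: QY].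
by have := polym_submod pf X Y; lra.
Qed.

Lemma polym_span f Y z X P : polym f -> f (Y `|` [set z]) <= f Y ->
  Y `<=` X -> P `<=` X `|` [set z] -> f P <= f X.
Proof.
move=> pf Yz YX PX.
have : f P + f Y <= f X + f (Y `|` [set z]); last by lra.
apply: polym_meet => // w.
by move=> /PX[Xw|zw]; [left|right; right].
Qed.

Section Frame.
Variables (f : set E -> R) (b : 'I_4 -> E).
Hypothesis fb : frame f b.
Let pf := frame_polym fb.

Lemma online_spanr i j a X P : online f b i j a -> X (b i) -> X a ->
  P `<=` X `|` [set b j] -> f P <= f X.
Proof.
case=> h1 h2 h3 h4 h5 Xb Xa; apply: (polym_span (Y := [set b i; a])) => //.
  rewrite h2 -h5; apply: (polym_mono pf); incl.
by move=> z /= [->|->].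
Qed.

Lemma online_spanl i j a X P : online f b i j a -> X (b j) -> X a ->
  P `<=` X `|` [set b i] -> f P <= f X.
Proof. by move=> /onlineC; exact: online_spanr. Qed.

Lemma online_span i j a X P : online f b i j a -> X (b i) -> X (b j) ->
  P `<=` X `|` [set a] -> f P <= f X.
Proof.
case=> h1 h2 h3 h4 h5 Xb Xa; apply: (polym_span (Y := [set b i; b j])) => //.
  by rewrite h4 -h5.
by move=> z /= [->|->].
Qed.

(** The points lie on two sides of a triangle that meet in [b j]: [b i] and [a] recover [b j], which
    with [c] recovers [b k]; symmetrically from [b k]. *)
Lemma online_hook i j k a c : uniq [:: i; j; k] ->
  online f b i j a -> online f b j k c ->
  [/\ f [set b i; a; c] = 3, f [set b k; a; c] = 3,
      f [set b i; b k; a; c] = 3 & f [set a; c] = 2].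
Proof.
move=> uijk la lc; have h3 := frame3 fb uijk.
have ac : f [set a; c] <= 2.
  have := polym_subadd [set a] [set c] pf.
  by rewrite (online_pt la) (online_pt lc); lra.
have iac_le : f [set b i; a; c] <= 3.
  have := polym_subadd [set b i; a] [set c] pf.
  by rewrite (online_l la) (online_pt lc); lra.
have kac_le : f [set b k; a; c] <= 3.
  have := polym_subadd [set b k; c] [set a] pf.
  rewrite (online_r lc) (online_pt la).
  suff -> : [set b k; a; c] = [set b k; c] `|` [set a] by lra.
  by apply/seteqP; split; incl.
have ijac : f [set b i; a; c; b j] <= f [set b i; a; c].
  by apply: (online_spanr la) ; incl.
have ijk : f [set b i; b j; b k] <= f [set b i; a; c; b j].
  by apply: (online_spanr lc) ; incl.
have kjac : f [set b k; a; c; b j] <= f [set b k; a; c].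
  by apply: (online_spanl lc) ; incl.
have kji : f [set b i; b j; b k] <= f [set b k; a; c; b j].
  by apply: (online_spanl la) ; incl.
have iac : f [set b i; a; c] = 3 by lra.
split=> //; first by lra.
- have h5 : f [set b i; b k; a; c] <= f [set b i; b j; b k; a].
    by apply: (online_span lc) ; incl.
  have h6 : f [set b i; b j; b k; a] <= f [set b i; b j; b k].
    by apply: (online_span la) ; incl.
  have : f [set b i; a; c] <= f [set b i; b k; a; c].
    by apply: (polym_mono pf); incl.
  by lra.
- have : f [set b i; a; c] <= f ([set b i] `|` [set a; c]).
    by apply: (polym_mono pf); incl.
  have := polym_subadd [set b i] [set a; c] pf.
  by rewrite (frame1 fb); lra.
Qed.

(* Two planes, one of them spanned by [b i], [b j], [b k] and the other one
   not contained in it, meet in rank at most two. *)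
Lemma plane_meet i j k l x P Q Z : uniq [:: i; j; k; l] ->
  f P <= 3 -> f Q <= 3 -> [set b i; b j; b k] `<=` Q ->
  online f b i l x -> P x -> Z `<=` P -> Z `<=` Q -> f Z <= 2.
Proof.
move=> u fP fQ bQ lx Px ZP ZQ; have h4 := frame4 fb u.
have : f [set b i; b j; b k; b l] <= f (P `|` Q).
  apply: (online_spanr lx); [by right; apply: bQ => /=; tauto|by left|].
  by move=> z [/bQ Qz|->]; [left; right|right].
have := @polym_meet f P Q (P `|` Q) Z pf (fun z h => h) ZP ZQ.
by lra.
Qed.

(** The four points span only the plane of [b i], [b k], [b l]. Once [a] is added, [b i] and [a']
    recover [b l], and [b i] and [a] recover [b j], so the rank is 4. *)
Lemma extension_indep i j k l a a' y' : uniq [:: i; j; k; l] ->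
  online f b i j a -> online f b i l a' -> online f b l k y' ->
  f ([set b i; b k; a'; y'] `|` [set a]) = f [set b i; b k; a'; y'] + f [set a].
Proof.
move=> u la la' ly'; have h4 := frame4 fb u.
have [_ _ hF _] := online_hook (uniq4_ilk u) la' ly'.
rewrite hF (online_pt la).
have := polym_subadd [set b i; b k; a'; y'] [set a] pf.
rewrite hF (online_pt la).
set X := _ `|` [set a].
have h1 : f (X `|` [set b l]) <= f X.
  by apply: (online_spanr la') ; rewrite /X; incl.
have h2 : f [set b i; b j; b k; b l] <= f (X `|` [set b l]).
  by apply: (online_spanr la); rewrite /X; incl.
by lra.
Qed.

(** Two lines through a common point span a plane. In the applications that point is e_{jl},
    collinear with s_{ij}, s_{il} and with s'_{jk}, s'_{lk}. *)
Lemma plane_desargues a a' y y' e : f [set a; a'; e] <= 2 ->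
  f [set y; y'; e] <= 2 -> f [set e] = 1 -> f [set a; a'; y; y'; e] <= 3.
Proof.
move=> h1 h2 he.
have : f [set a; a'; y; y'; e] + f [set e] <= f [set a; a'; e] + f [set y; y'; e].
  by apply: polym_meet => //; incl.
lra.
Qed.

(* [t] lies in the plane of [a], [a'], [y], [y'], which meets the plane of
   [b i], [b j], [b k] in the line through [a] and [y]. *)
Lemma coll_transfer i j k l a a' y y' e t : uniq [:: i; j; k; l] ->
  online f b i j a -> online f b i l a' -> online f b j k y ->
  online f b l k y' -> f [set e] = 1 ->
  f [set a; a'; e] <= 2 -> f [set y; y'; e] <= 2 ->
  online f b i k t -> f [set a'; y'; t] <= 2 -> f [set a; y; t] <= 2.
Proof.
move=> u la la' ly ly' he cae cye lt ct.
have [_ _ _ ay2] := online_hook (uniq4_ilk u) la' ly'.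
have P3 := plane_desargues cae cye he.
have P3' : f [set a; a'; y; y'; e; t] <= 3.
  apply: (le_trans _ P3).
  apply: (polym_span pf (Y := [set a'; y']) (z := t)); [|incl|incl].
  by rewrite ay2.
have h3 : f [set b i; b j; b k] = 3 by apply: (frame3 fb); exact: uniq4_ijk u.
have Q3 : f [set b i; b j; b k; a; y; t] <= 3.
  rewrite -h3; apply: (@le_trans _ _ (f [set b i; b j; b k; a; y])).
    by apply: (online_span lt) ; incl.
  apply: (@le_trans _ _ (f [set b i; b j; b k; a])).
    by apply: (online_span ly) ; incl.
  by apply: (online_span la) ; incl.
apply: (plane_meet u P3' Q3 _ la'); incl.
Qed.

(** The plane of the line [a], [c], [e] and the point [y] contains [t1] and [t2]. All of [t1], [t2],
    [e] also lie in the plane of [b i], [b j], [b k], and [a] witnesses that the planes differ. *)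
Lemma coll_triangle i j k l a c y t1 t2 e : uniq [:: i; j; k; l] ->
  online f b i l a -> online f b k l c -> online f b l j y ->
  online f b i j t1 -> online f b k j t2 -> online f b k i e ->
  f [set a; c; e] <= 2 -> f [set a; y; t1] <= 2 -> f [set c; y; t2] <= 2 ->
  f [set t1; t2; e] <= 2.
Proof.
move=> u la lc ly l1 l2 le ce c1 c2.
have [_ _ _ ay2] := online_hook (uniq4_ilj u) la ly.
have [_ _ _ cy2] := online_hook (uniq4_klj u) lc ly.
have P3 : f [set a; c; e; y] <= 3.
  by have := polym_subadd [set a; c; e] [set y] pf; rewrite (online_pt ly); lra.
have P3' : f [set a; c; e; y; t1; t2] <= 3.
  apply: (le_trans _ P3); apply: (@le_trans _ _ (f [set a; c; e; y; t1])).
    by apply: (polym_span pf (Y := [set c; y]) (z := t2)); [rewrite cy2|incl|incl].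
  by apply: (polym_span pf (Y := [set a; y]) (z := t1)); [rewrite ay2|incl|incl].
have h3 := frame3 fb (uniq4_ijk u).
have Q3 : f [set b i; b j; b k; t1; t2; e] <= 3.
  rewrite -h3; apply: (@le_trans _ _ (f [set b i; b j; b k; t1; t2])).
    by apply: (online_span le) ; incl.
  apply: (@le_trans _ _ (f [set b i; b j; b k; t1])).
    by apply: (online_span l2) ; incl.
  by apply: (online_span l1) ; incl.
apply: (plane_meet u P3' Q3 _ la); incl.
Qed.

Lemma extension_online i j k l a a' y y' t g : uniq [:: i; j; k; l] ->
  online f b i j a -> online f b j k y -> polym g ->
  g [set b i; b k] = 2 ->
  (forall A, A `<=` [set b i; b k; a'; y'] ->
    g (A `|` [set t]) = f (A `|` [set a; y]) - f [set a]) ->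
  online g b i k t.
Proof.
move=> u la ly pg gik gt.
have [h1 h2 h3 h4] := online_hook (uniq4_ijk u) la ly.
have ha := online_pt la.
split=> //.
- by have := gt set0 (@sub0set _ _); rewrite !set0U h4 ha => ->; lra.
- by rewrite gt; [rewrite setUA h1 ha; lra|incl].
- by rewrite gt; [rewrite setUA h2 ha; lra|incl].
- by rewrite gt; [rewrite setUA h3 ha; lra|incl].
Qed.

(** Contracting [a] turns the plane of [a], [a'], [y], [y'] into a line. *)
Lemma extension_coll i j k l a a' y y' e t g : uniq [:: i; j; k; l] ->
  online f b i j a -> f [set e] = 1 ->
  f [set a; a'; e] <= 2 -> f [set y; y'; e] <= 2 ->
  (forall A, A `<=` [set b i; b k; a'; y'] ->
    g (A `|` [set t]) = f (A `|` [set a; y]) - f [set a]) ->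
  g [set a'; y'; t] <= 2.
Proof.
move=> u la he ca cy gt; rewrite gt; last by incl.
have := plane_desargues ca cy he.
have : f ([set a'; y'] `|` [set a; y]) <= f [set a; a'; y; y'; e].
  by apply: (polym_mono pf); incl.
by rewrite (online_pt la); lra.
Qed.

End Frame.
End Geometry.

Lemma ord4_cover (i j k l m : 'I_4) : uniq [:: i; j; k; l] ->
  [\/ m = i, m = j, m = k | m = l].
Proof.
move=> u; have [||_ cover] := @uniq_min_size _ [:: i; j; k; l] (enum 'I_4) u.
- by move=> z _; rewrite mem_enum.
- by rewrite size_enum_ord.
have : m \in [:: i; j; k; l] by rewrite cover mem_enum.
by rewrite !inE => /or4P[] /eqP ->;
  [exact: Or41|exact: Or42|exact: Or43|exact: Or44].
Qed.

Lemma ord4_avoid (s : seq 'I_4) : (size s < 4)%N -> exists j, j \notin s.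
Proof.
move=> ss; have [j js|sT] := pickP [predC s]; first by exists j.
have : #|[predC s]| = 0%N by exact: eq_card0.
move=> /eqP; rewrite -(eqn_add2l #|s|) cardC card_ord addn0 => /eqP h.
by have := card_size s; rewrite -h leqNgt ss.
Qed.

(** * Adjoining one product and its inverse *)

Section Step.
Variables (R : realType) (E S : Type) (b : 'I_4 -> E).
Variables (el : 'I_4 -> 'I_4 -> S -> E) (inv : S -> S) (e : S).
Hypothesis invK : involutive inv.
Hypothesis elC : forall (i j : 'I_4) s, i != j -> el j i (inv s) = el i j s.
Hypothesis el_b : forall (i j k : 'I_4) s, i != j -> el i j s <> b k.
Hypothesis el_inj : forall (i j k l : 'I_4) s t, i != j -> k != l ->
  el i j s = el k l t ->
  [/\ i = k, j = l & s = t] \/ [/\ i = l, j = k & s = inv t].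

(** In [good_tri], s_{kj} stands for the inverse of s on (j, k), and an upper bound suffices because
    [online_hook] supplies the reverse inequality. *)
Record good (f : set E -> R) (Sig : set S) : Prop := Good {
  good_frame : frame f b;
  good_line : forall s (i j : 'I_4), Sig s -> i != j -> online f b i j (el i j s);
  good_tri : forall s (i j k : 'I_4), Sig s -> uniq [:: i; j; k] ->
    f [set el i j s; el k j s; el k i e] <= 2 }.

Definition prodr (f : set E -> R) x y t :=
  forall i j k : 'I_4, uniq [:: i; j; k] ->
  f [set el i j x; el j k y; el i k t] <= 2.

(** The point of [t] on (k, i) is that of [inv t] on (i, k), so [inv t <> t] keeps the points
    adjoined for the two orders apart. *)
Lemma good_step (f : set E -> R) (Sig : set S) x y t :
  aent f -> good f Sig -> (forall s, Sig s -> Sig (inv s)) -> Sig e ->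
  Sig x -> Sig y -> ~ Sig t -> inv t <> t ->
  exists g, [/\ aent g,
    forall A, (forall i j : 'I_4, i != j -> ~ A (el i j t)) -> g A = f A,
    good g (Sig `|` [set t; inv t]) & prodr g x y t].
Proof.
move=> af [ff fl ftri] SigV Se Sx Sy NSt tNV.
have NSVt : ~ Sig (inv t) by move=> /SigV; rewrite invK.
(* For (i, k) this chooses the other two indices (j, l): x_{ij} is contracted, while l occurs in
   [F]. *)
have /choice[rest restP] : forall p : 'I_4 * 'I_4, exists jl : 'I_4 * 'I_4,
    p.1 != p.2 -> uniq [:: p.1; jl.1; p.2; jl.2].
  move=> [i k]; have [j] := @ord4_avoid [:: i; k] isT.
  rewrite !inE negb_or => /andP[ji jk].
  have [l] := @ord4_avoid [:: i; j; k] isT.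
  rewrite !inE !negb_or => /and3P[li lj lk].
  exists (j, l) => ik; rewrite [uniq _]uniq4E.
  by rewrite ik (eq_sym i j) ji (eq_sym i l) li jk (eq_sym j l) lj
    (eq_sym k l) lk.
pose old := [set z | (exists k, z = b k) \/
  exists i j s, [/\ i != j, Sig s & z = el i j s]].
have oldb k : old (b k) by left; exists k.
have oldel i j s : i != j -> Sig s -> old (el i j s).
  by move=> ij ss; right; exists i, j, s.
have Nold i j : i != j -> ~ old (el i j t).
  move=> ij [[k /el_b]//|[k [l [s [kl ss /el_inj]]]]].
  by case=> // -[_ _ ts]; [|]; move: NSt; rewrite ts//; apply; exact: SigV.
pose ps := [seq p <- enum {: 'I_4 * 'I_4} | p.1 != p.2].
have psP i k : i != k -> (i, k) \in ps.
  by move=> ik; rewrite mem_filter /= ik mem_enum.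
have psN p : p \in ps -> p.1 != p.2 by rewrite mem_filter => /andP[].
pose F (p : 'I_4 * 'I_4) : set E :=
  [set b p.1; b p.2; el p.1 (rest p).2 x; el (rest p).2 p.2 y].
have [||p /psN pN|p /psN pN|g [ag gf gt]] :=
  @aent_extend_seq _ _ _ f old F (fun p => el p.1 p.2 t)
  (fun p => el p.1 (rest p).1 x) (fun p => el (rest p).1 p.2 y) ps af.
- by rewrite filter_uniq// enum_uniq.
- move=> [i k] [j l] /psN /= ik /psN /= jl /el_inj[]// [-> -> //].
  by move=> /esym.
- have := restP _ pN; rewrite uniq4E => /and5P[h1 h2 h3 h4 /andP[h5 h6]].
  split; [|exact: oldel|exact: oldel|exact: Nold].
  move=> z [[[->|->]|->]|->] //; apply: oldel => //.
  by rewrite eq_sym.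
- have u := restP _ pN.
  have := u; rewrite uniq4E => /and5P[h1 h2 h3 h4 /andP[h5 h6]].
  apply: (extension_indep ff u); [exact: fl|exact: fl|].
  by apply: fl => //; rewrite eq_sym.
have gold A : A `<=` old -> g A = f A.
  by move=> Ao; apply: gf => p /psN pN /Ao; exact: Nold.
have pg := aent_polym ag.
have gff : frame g b.
  split=> // [i|i j k u|i j k l u]; rewrite gold.
  - exact: frame1 ff i.
  - by move=> _ ->.
  - exact: frame3 ff _ _ _ u.
  - by move=> _ [[]|] ->.
  - exact: frame4 ff _ _ _ _ u.
  - by move=> _ [[[]|]|] ->.
have gfl s i j : Sig s -> i != j -> online g b i j (el i j s).
  move=> ss ij; have [h1 h2 h3 h4 h5] := fl _ _ _ ss ij.
  split; rewrite gold//.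
  - by move=> _ ->; exact: oldel.
  - by move=> _ [] ->; [|exact: oldel].
  - by move=> _ [] ->; [|exact: oldel].
  - by move=> _ [] ->.
  - by move=> _ [[]|] ->; [| |exact: oldel].
have gtri s i j k : Sig s -> uniq [:: i; j; k] ->
    g [set el i j s; el k j s; el k i e] <= 2.
  move=> ss u; rewrite gold ?ftri//.
  move: u; rewrite uniq3E => /and3P[h1 h2 h3].
  by move=> _ [[]|] ->; apply: oldel => //; rewrite eq_sym.
(* The new point is collinear with x_{il}, y_{lk} by construction and with x_{ij}, y_{jk} by
   transfer, so the product relation holds for either middle index. *)
have key i k : i != k -> online g b i k (el i k t) /\
    g [set el i (rest (i, k)).2 x; el (rest (i, k)).2 k y; el i k t] <= 2 /\
    g [set el i (rest (i, k)).1 x; el (rest (i, k)).1 k y; el i k t] <= 2.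
  move=> ik.
  have gtik A : A `<=` F (i, k) -> g (A `|` [set el i k t]) = _ :=
    gt (i, k) A (psP _ _ ik).
  move: gtik (restP (i, k) ik : uniq [:: i; (rest (i, k)).1; k; (rest (i, k)).2]).
  rewrite /F/=; set j := (rest _).1; set l := (rest _).2 => gtik.
  rewrite -/(uniq [:: i; j; k; l]) => u.
  have := u; rewrite uniq4E => /and5P[h1 h2 h3 h4 /andP[h5 h6]].
  have gik : g [set b i; b k] = 2.
    by have := online_b (gfl _ _ _ Se ik).
  have lt : online g b i k (el i k t).
    by apply: (extension_online ff u _ _ pg gik gtik); exact: fl.
  (* The triangle axiom concerns points of a symbol with the same second index; applied to [inv x]
     it concerns points of [x] with the same first index. *)
  have cx : f [set el i j x; el i l x; el j l e] <= 2.
    have := ftri (inv x) l i j (SigV _ Sx); rewrite !elC//.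
    rewrite uniq3E (eq_sym l i) h3 (eq_sym l j) h5 h1.
    by rewrite [[set el i l x; _]]setUC; exact.
  have cy : f [set el j k y; el l k y; el j l e] <= 2.
    have := ftri y l k j Sy.
    rewrite uniq3E (eq_sym l k) h6 (eq_sym l j) h5 (eq_sym k j) h4.
    by rewrite [[set el l k y; _]]setUC; exact.
  have lk : l != k by rewrite eq_sym.
  have he : f [set el j l e] = 1 by exact: online_pt (fl _ _ _ Se h5).
  have ct := extension_coll ff u (fl _ _ _ Sx h1) he cx cy gtik.
  split=> //; split=> //.
  apply: (@coll_transfer _ _ g b gff i j k l _ _ _ _ (el j l e) _ u) ct;
    rewrite ?gold//; try exact: gfl.
  - by move=> _ ->; exact: oldel.
  - by move=> _ [[]|] ->; exact: oldel.
  - by move=> _ [[]|] ->; exact: oldel.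
have gp : prodr g x y t.
  move=> i j k; rewrite uniq3E => /and3P[ij ik jk].
  have [_ [c1 c2]] := key _ _ ik.
  have [ji|->//|jk'|->//] := ord4_cover j (restP (i, k) ik).
    by rewrite ji eqxx in ij.
  by rewrite jk' eqxx in jk.
have gl s i j : (Sig `|` [set t; inv t]) s -> i != j ->
    online g b i j (el i j s).
  move=> [ss|[->|->]] ij; first exact: gfl.
    by have [] := key _ _ ij.
  by rewrite elC 1?eq_sym//; apply: onlineC; have [] := key j i; rewrite 1?eq_sym.
exists g; split=> //.
  by move=> A At; apply: gf => p /psN; exact: At.
split=> // s i j k ss u.
have := u; rewrite uniq3E => /and3P[ij ik jk].
have [ji ki kj] : [/\ j != i, k != i & k != j] by split; rewrite eq_sym.
have uik := restP (i, k) ik.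
have [l ul] : exists l, uniq [:: i; j; k; l].
  have [l] := @ord4_avoid [:: i; j; k] isT.
  rewrite !inE !negb_or => /and3P[li lj lk]; exists l.
  by rewrite uniq4E ij ik (eq_sym i l) li jk (eq_sym j l) lj (eq_sym k l) lk.
have := ul; rewrite uniq4E => /and5P[_ _ il _ /andP[jl kl]].
have [li lj lk] : [/\ l != i, l != j & l != k] by split; rewrite eq_sym.
case: ss => [ss|[->|->]]; first exact: gtri.
  apply: (@coll_triangle _ _ g b gff i j k l (el i l x) (el k l x) (el l j y));
    rewrite //; try exact: gfl.
  - exact: (key _ _ ij).1.
  - exact: (key _ _ kj).1.
  - by apply: gtri => //; rewrite uniq3E il ik lk.
  - by apply: gp; rewrite uniq3E il ij lj.
  - by apply: gp; rewrite uniq3E kl kj lj.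
(* For [inv t] the roles of [x] and [y] are exchanged, as inversion reverses products. *)
rewrite !elC//.
apply: (@coll_triangle _ _ g b gff i j k l (el l i y) (el l k y) (el j l x));
  rewrite //; try (by apply: onlineC; exact: gfl); try exact: gfl.
- by apply: onlineC; exact: (key _ _ ji).1.
- by apply: onlineC; exact: (key _ _ jk).1.
- have := gtri (inv y) i l k (SigV _ Sy); rewrite !elC//; apply.
  by rewrite uniq3E il ik lk.
- by rewrite [[set el l i y; _]]setUC; apply: gp; rewrite uniq3E jl ji li.
- by rewrite [[set el l k y; _]]setUC; apply: gp; rewrite uniq3E jl jk lk.
Qed.

End Step.

(** * Random variables and their kernels *)

Section EntropyConversion.
Variable R : realType.

Lemma entropy_relent (W : finType) (p : W -> R) (T : Type)
    (Y : W -> {classic T}) :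
  entropy p Y = relent p (fun w u => `[< Y w = Y u >]).
Proof.
rewrite /entropy /relent; congr (- _).
pose s := undup [seq Y w | w <- enum W].
have rs : range Y = [set` s].
  apply/seteqP; split=> [_ [w _ <-]|y]; rewrite /= mem_undup.
    by apply/mapP; exists w; rewrite ?mem_enum.
  by move=> /mapP[w _ ->]; exists w.
have massE w : prob_eq p Y (Y w) = mass p (fun w u => `[< Y w = Y u >]) w.
  by apply: eq_bigl => u; apply/asboolP/asboolP.
rewrite rs -fsbig_seq ?undup_uniq//.
transitivity (\sum_(y <- s) \sum_(w | Y w == y)
    p w * ln (mass p (fun w u => `[< Y w = Y u >]) w)).
  apply: eq_bigr => y _; rewrite {1}/prob_eq mulr_suml.
  apply: eq_big => [w|w /asboolP <-]; last by rewrite massE.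
  by apply/asboolP/eqP.
rewrite (exchange_big_dep xpredT)//=; apply: eq_bigr => w _.
rewrite big_mkcond (bigD1_seq (Y w)) ?undup_uniq//=; last first.
  by rewrite mem_undup; apply/mapP; exists w; rewrite ?mem_enum.
by rewrite eqxx big1 ?addr0// => y yw; rewrite eq_sym (negbTE yw).
Qed.

Lemma joint_eq (W : finType) (E : Type) (V : E -> Type) (X : forall i, W -> V i)
    (A : set E) w u :
  joint X A w = joint X A u <-> forall i, A i -> X i w = X i u.
Proof.
split=> [h i Ai|h].
  by have := congr1 (fun g => g (SigSub (mem_set Ai))) h.
apply: functional_extensionality_dep => -[i /= iA]; apply: h.
exact: set_mem.
Qed.

Lemma entropic_ent (E : Type) (f : polymatroid R E) : entropic f -> ent f.
Proof.
move=> [W [p [V [X [dp fE]]]]].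
exists W, p, (fun i w u => `[< X i w = X i u >]); split=> // [i x y z|A].
  split; first exact/asboolP.
  by move=> /asboolP xy; apply/asboolP/asboolP; rewrite xy.
rewrite fE entropy_relent; congr relent; apply/funext => w; apply/funext => u.
apply/asboolP/asboolP => [/joint_eq h i Ai|h]; first by apply/asboolP; exact: h.
by apply/joint_eq => i Ai; apply/asboolP; exact: h.
Qed.

(** There are finitely many pairs of sample points, and each pair separated by [A] is separated by
    one element of [A]; these elements form a finite set with the same kernel as [A]. *)
Lemma ent_finite_type (E : Type) (f : set E -> R) : ent f -> finite_type f.
Proof.
move=> ef; have pf := ent_polym ef; move: ef => [W [p [K [dp KE fE]]]] A.
have /choice[c cP] : forall wu : W * W, exists i : option E,
    ~~ jker K A wu.1 wu.2 ->
    if i is Some i then A i /\ ~ K i wu.1 wu.2 else False.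
  move=> [w u]; have [|] := boolP (jker K A w u); first by exists None.
  move=> /asboolPn/existsNP[i /not_implyP[Ai Ki]]; by exists (Some i).
pose F := [set i | exists wu, ~~ jker K A wu.1 wu.2 /\ c wu = Some i].
have finF : finite_set F.
  apply: (@sub_finite_set _ _ (Some @^-1` (range c))).
    by move=> i [wu [_ ci]]; exists wu.
  apply: finite_preimage; first by move=> x y _ _ [].
  by apply: finite_image; exact: finite_finset.
have FA : F `<=` A by move=> i [wu [/cP + ci]]; rewrite ci => -[].
have fFA : f F = f A.
  rewrite !fE; congr relent; apply/funext => w; apply/funext => u.
  apply/idP/idP; last exact: jkerS.
  apply: contraTT => wu; apply/asboolPn => h.
  have := cP (w, u) wu; case ci : (c (w, u)) => [i|//] [Ai]; apply.
  by apply: h; exists (w, u).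
apply/esym/eqP; rewrite eq_le; apply/andP; split.
  apply: ge_sup; first by exists (f F), F.
  by move=> _ [G [_ GA] <-]; apply: (polym_mono pf).
apply: ub_le_sup; last by exists F.
by exists (f A) => _ [G [_ GA] <-]; apply: (polym_mono pf).
Qed.

Lemma ent_entropic (E : Type) (f : set E -> R) : ent f ->
  exists2 g : polymatroid R E, entropic g & forall A, g A = f A.
Proof.
move=> ef; have [p0 pm ps] := ent_polym ef.
exists (Polymatroid p0 pm ps (fun _ => ent_finite_type ef)) => //.
move: ef => [W [p [K [dp KE fE]]]].
(* The variable at [i] maps a sample point to its class, as a predicate on [W]. *)
exists W, p, (fun=> W -> bool), K; split=> //= A.
rewrite fE entropy_relent; congr relent; apply/funext => w; apply/funext => u.
apply/asboolP/asboolP => [h|/joint_eq h i Ai].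
  by apply/joint_eq => i /h iwu; apply/funext; exact: eqrel_eq.
by rewrite h//; exact: eqrel_refl.
Qed.

Lemma almost_entropic_aent (E : Type) (f : polymatroid R E) :
  almost_entropic f -> aent f.
Proof.
move=> [_ [g [eg gf]]] l e e0.
have : \forall n \near \oo, forall A, A \in l -> `|g n A - f A| < e.
  by apply: filter_seq => A _; have /cvgrPdistC_lt := gf A; apply.
move=> [n _ /(_ n (leqnn n)) h]; exists (g n) => //.
exact: entropic_ent.
Qed.

End EntropyConversion.

Lemma finite_subsets (T : Type) (N : set T) : finite_set N ->
  exists l : seq (set T), forall A, A `<=` N -> A \in l.
Proof.
move=> finN; have /finite_seqP[s Ns] : finite_set (N : set {classic T}) by [].
suff H (r : seq {classic T}) : exists l : seq (set T),
    forall A, A `<=` [set` r] -> A \in l by rewrite [N]Ns; exact: H.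
elim: r => [|x r [l lP]].
  by exists [:: set0] => A; rewrite set_nil subset0 => ->; rewrite inE.
exists (l ++ [seq x |` A | A <- l]) => A Ar; rewrite mem_cat.
have [Ax|Ax] := pselect (A x).
  apply/orP; right; apply/mapP; exists (A `\ x); last by rewrite setD1K.
  by apply: lP => z [/Ar /=]; rewrite inE => /predU1P[->|].
apply/orP; left; apply: lP => z Az; have /= := Ar _ Az.
by rewrite inE => /predU1P[zx|//]; rewrite zx in Az.
Qed.

Lemma polym_span_finite (R : realType) (E : Type) (f : set E -> R)
    (X Z : set E) :
  polym f -> finite_set Z -> (forall z, Z z -> f (X `|` [set z]) <= f X) ->
  f (X `|` Z) <= f X.
Proof.
move=> pf finZ; have /finite_seqP[s Zs] : finite_set (Z : set {classic E}) by [].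
suff H (r : seq {classic E}) :
    (forall z : {classic E}, z \in r -> f (X `|` [set z]) <= f X) ->
    f (X `|` [set` r]) <= f X.
  by move=> h; rewrite [Z]Zs; apply: H => z zs; apply: h; rewrite Zs.
elim: r => [|x r IH] h; first by rewrite set_nil setU0.
have hx := h x (mem_head _ _).
have := IH (fun z zr => h z (mem_behead (s := x :: r) zr)); apply: le_trans.
apply: (polym_span pf hx); first by move=> z; left.
move=> z [Xz|/=]; first by left; left.
by rewrite inE => /predU1P[->|zr]; [right|left; right].
Qed.

(** * Limits of increasing towers *)

Section TowerLimit.
Variables (R : realType) (E : Type) (f : nat -> set E -> R).
Variables (old : nat -> set E) (M : R).
Hypothesis f_aent : forall n, aent (f n).
Hypothesis old_finite : forall n, finite_set (old n).
Hypothesis f_supp : forall n A, f n A = f n (A `&` old n).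
Hypothesis f_step : forall n A, A `<=` old n -> f n.+1 A = f n A.
Hypothesis f_bound : forall n, f n setT <= M.
Hypothesis old_step : forall n, old n `<=` old n.+1.

Let f_polym n := aent_polym (f_aent n).

(** Elements outside [old n] are loops at stage [n] and can only gain rank later. *)
Lemma tower_nd A : nondecreasing_seq (f ^~ A).
Proof.
apply/nondecreasing_seqP => n; rewrite f_supp -f_step; last by move=> z [].
by apply: (polym_mono (f_polym n.+1)) => z [].
Qed.

Definition tower_lim A : R := sup (range (f ^~ A)).

Lemma tower_cvg A : f ^~ A @ \oo --> tower_lim A.
Proof.
apply: nondecreasing_cvgn; first exact: tower_nd.
exists M => _ [n _ <-]; apply: le_trans (f_bound n).
by apply: (polym_mono (f_polym n)).
Qed.

Lemma tower_old n m A : (n <= m)%N -> A `<=` old n -> f m A = f n A.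
Proof.
move=> /subnKC <-; elim: (m - n)%N => [|k IH]; first by rewrite addn0.
move=> An; rewrite addnS f_step ?IH// => z /An.
by elim: (k) => [|j IHj]; rewrite ?addn0// addnS => /IHj; exact: old_step.
Qed.

Lemma tower_lim_old n A : A `<=` old n -> tower_lim A = f n A.
Proof.
move=> An; apply: (cvg_unique (@norm_hausdorff _ _) (tower_cvg (A := A))).
apply: cvg_near_cst; exists n => // m /= nm; exact: tower_old.
Qed.

Lemma tower_le n A : f n A <= tower_lim A.
Proof.
rewrite f_supp -(@tower_lim_old n); last by move=> z [].
apply: (ler_cvg_to (tower_cvg (A := _)) (tower_cvg (A := A))).
by apply: nearW => m; apply: (polym_mono (f_polym m)) => z [].
Qed.

Lemma tower_polym : polym tower_lim.
Proof.
split.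
- by rewrite (@tower_lim_old 0) ?(polym0 (f_polym 0))//; apply: sub0set.
- move=> A B AB; apply: (ler_cvg_to (tower_cvg (A := A)) (tower_cvg (A := B))).
  by apply: nearW => m; exact: (polym_mono (f_polym m)).
- move=> A B.
  have cD X Y : (fun n => f n X + f n Y) @ \oo --> tower_lim X + tower_lim Y.
    by apply: cvgD; exact: tower_cvg.
  apply: (ler_cvg_to (cD (A `|` B) (A `&` B)) (cD A B)).
  by apply: nearW => m; exact: (polym_submod (f_polym m)).
Qed.

(** As [f n] is supported on a finite set, [f n A] is at most the value of the limit on a finite
    subset of [A]. *)
Lemma tower_finite_type : finite_type tower_lim.
Proof.
move=> A; have mono := polym_mono tower_polym.
have ub : has_ubound [set tower_lim F | F in [set F | finite_set F /\ F `<=` A]].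
  by exists (tower_lim A) => _ [G [_ GA] <-]; exact: mono.
apply/eqP; rewrite eq_le; apply/andP; split; last first.
  apply: ge_sup; first by exists (tower_lim set0), set0 => //; split.
  by move=> _ [G [_ GA] <-]; exact: mono.
apply: (ler_cvg_to (tower_cvg (A := A)) (cvg_cst _)).
apply: nearW => n; rewrite f_supp.
apply: (le_trans (tower_le n _)); apply: ub_le_sup => //.
exists (A `&` old n) => //; split; last by move=> z [].
exact: finite_setIr.
Qed.

(** Approximating on the finitely many subsets of [old n] and making all other elements loops
    controls every [A] uniformly. This turns the closure back into a sequence. *)
Lemma tower_approx n : exists2 g : polymatroid R E, entropic g &
  forall A, `|g A - f n A| < n.+1%:R^-1.
Proof.
have [l lP] := finite_subsets (old_finite n).
have [h eh hf] := @f_aent n l n.+1%:R^-1 (ltac:(by rewrite invr_gt0)).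
have [g eg gE] := ent_entropic (ent_comap (fun i => [set i] `&` old n) eh).
exists g => // A; rewrite gE f_supp.
have -> : \bigcup_(i in A) ([set i] `&` old n) = A `&` old n.
  by apply/seteqP; split=> [z [i Ai [-> //]]|z [Az oz]]; exists z.
by apply: hf; apply: lP => z [].
Qed.

Lemma tower_almost_entropic : exists F : polymatroid R E,
  almost_entropic F /\ forall n A, A `<=` old n -> F A = f n A.
Proof.
have [p0 pm ps] := tower_polym.
exists (Polymatroid p0 pm ps (fun=> tower_finite_type)).
split; last by move=> n A; exact: tower_lim_old.
split; first exact: tower_finite_type.
have /choice[g gP] : forall n, exists g : polymatroid R E,
    entropic g /\ forall A, `|g A - f n A| < n.+1%:R^-1.
  by move=> n; have [g] := tower_approx n; exists g.
exists g; split=> [n|A /=]; first by have [] := gP n.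
have -> : (fun n => g n A) = (fun n => (g n A - f n A) + f n A).
  by apply/funext => n; rewrite subrK.
rewrite -[tower_lim A]add0r; apply: cvgD; last exact: tower_cvg.
apply/cvgrPdist_lt => e e0; have := @cvg_harmonic R.
move=> /cvgrPdist_lt/(_ e e0); apply: filterS => n /=.
rewrite !sub0r !normrN => h; have [_ /(_ A)/lt_trans] := gP n; apply.
exact: le_lt_trans (ler_norm _) h.
Qed.

End TowerLimit.

(** * Closing the symbol set under products *)

Lemma inj_unbounded (h : nat -> nat) : injective h ->
  forall N, exists k, (N <= h k)%N.
Proof.
move=> hinj N; apply: contrapT => /forallNP hN.
have hlt k : (h k < N)%N by rewrite ltnNge; apply/negP; exact: hN.
have : injective (fun k : 'I_N.+1 => Ordinal (hlt k)).
  by move=> x y [] /hinj /val_inj.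
by move=> /leq_card; rewrite !card_ord ltnn.
Qed.

(** The second coordinate of [h] makes every value recur infinitely often, so that a pair of symbols
    comes up again after both have been constructed. *)
Lemma enum_often (T : Type) (t0 : T) (h : T * nat -> nat) : injective h ->
  exists dec : nat -> T, forall z N, exists m, (N <= m)%N /\ dec m = z.
Proof.
move=> hinj.
have /choice[dec decP] : forall n, exists z : T,
    forall z' k, h (z', k) = n -> z = z'.
  move=> n; have [[[z k] zk]|nh] := pselect (exists zk, h zk = n).
    exists z => z' k' zk'; have := hinj (z, k) (z', k').
    by rewrite zk zk' => /(_ erefl)[].
  by exists t0 => z' k zk; exfalso; apply: nh; exists (z', k).
exists dec => z N.
have [|k Nk] := @inj_unbounded (fun k => h (z, k)) _ N; first by move=> x y /hinj[].
by exists (h (z, k)); split=> //; exact: (decP _ _ k).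
Qed.

Lemma image_seq_cons (T : eqType) (U : Type) (g : T -> U) (x : T) (s : seq T) :
  g @` [set` x :: s] = g x |` g @` [set` s].
Proof.
apply/seteqP; split=> [y [z /= + gz]|y [->|[z zs <-]]].
- by rewrite inE -gz => /predU1P[->|zs]; [left|right; exists z].
- by exists x => //=; exact: mem_head.
- by exists z => //=; rewrite inE [z \in s]zs orbT.
Qed.

Lemma image_seq_nil (T : eqType) (U : Type) (g : T -> U) :
  g @` [set` [::]] = set0.
Proof. by apply/seteqP; split=> [y [z]|]. Qed.

Section Extension.
Variables (R : realType) (D : pdg R 4).
Hypotheses (finD : pdg_finite D) (aeD : pdg_almost_entropic D).

(* The [k]-th new symbol is [inr (k, true)], its inverse [inr (k, false)]. *)
Definition xsymb : Type := (symb D + nat * bool)%type.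

Definition xinv (s : xsymb) : xsymb :=
  match s with inl s => inl (sinv s) | inr (k, c) => inr (k, ~~ c) end.

Definition xid : xsymb := inl (sid D).

Definition upair : Type := {p : 'I_4 * 'I_4 | (p.1 < p.2)%N}.

Definition xground : Type := ('I_4 + upair * xsymb)%type.

Definition xbasis (i : 'I_4) : xground := inl i.

(* Junk value [inl i] unless [i < j]. *)
Definition xcopy (i j : 'I_4) (s : xsymb) : xground :=
  if (insub (i, j) : option upair) is Some u then inr (u, s) else inl i.

Definition xel (i j : 'I_4) (s : xsymb) : xground :=
  if (i < j)%N then xcopy i j s else xcopy j i (xinv s).

Let dP := pdgP D.

Lemma xinvK : involutive xinv.
Proof. by case=> [s|[k c]] /=; rewrite ?(pdg_invK dP) ?negbK. Qed.

Lemma xcopyE (u : upair) s : xcopy (val u).1 (val u).2 s = inr (u, s).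
Proof. by rewrite /xcopy -surjective_pairing valK. Qed.

Variant xel_spec (i j : 'I_4) (s : xsymb) : xground -> Type :=
| XelLt (u : upair) of val u = (i, j) & (i < j)%N : xel_spec i j s (inr (u, s))
| XelGt (u : upair) of val u = (j, i) & (j < i)%N & (i < j)%N = false :
    xel_spec i j s (inr (u, xinv s)).

Lemma xelP (i j : 'I_4) s : i != j -> xel_spec i j s (xel i j s).
Proof.
move=> ij; rewrite /xel; case: ltngtP => [lt|gt|/val_inj e].
- pose u : upair := exist _ (i, j) lt.
  by rewrite (xcopyE u); constructor.
- pose u : upair := exist _ (j, i) gt.
  by rewrite (xcopyE u); constructor => //; rewrite ltnNge ltnW.
- by rewrite e eqxx in ij.
Qed.

Lemma xelC (i j : 'I_4) s : i != j -> xel j i (xinv s) = xel i j s.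
Proof.
move=> ij; rewrite /xel xinvK; case: ltngtP => // /val_inj e.
by rewrite e eqxx in ij.
Qed.

Lemma xel_b (i j k : 'I_4) s : i != j -> xel i j s <> xbasis k.
Proof. by move=> ij; case: xelP. Qed.

Lemma xel_inj (i j k l : 'I_4) s t : i != j -> k != l ->
  xel i j s = xel k l t ->
  [/\ i = k, j = l & s = t] \/ [/\ i = l, j = k & s = xinv t].
Proof.
move=> ij kl.
case: (xelP s ij) => [u uij _|u uij _ _];
  case: (xelP t kl) => [v vkl _|v vkl _ _].
- by case=> uv st; left; move: uij; rewrite uv vkl => -[].
- by case=> uv st; right; move: uij; rewrite uv vkl => -[].
- by case=> uv st; right; move: uij; rewrite uv vkl => -[-> ->]; rewrite -st xinvK.
- by case=> uv /(inv_inj xinvK) st; left; move: uij; rewrite uv vkl => -[].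
Qed.

(** Set-valued so that elements of new symbols can have empty origin, which makes them loops of
    [base_rank]. *)
Definition origin (z : xground) : set (ground D) :=
  match z with
  | inl k => [set Defs.basis D k]
  | inr (u, inl s) => [set copy (val u).1 (val u).2 s]
  | inr (_, inr _) => set0
  end.

Lemma origin_el (i j : 'I_4) (s : symb D) : i != j ->
  origin (xel i j (inl s)) = [set elt i j s].
Proof.
by move=> ij; rewrite /elt; case: xelP => //= u -> => [->|_ ->].
Qed.

Lemma origin_inj z z' x : origin z = [set x] -> origin z' = [set x] -> z = z'.
Proof.
have e (y : ground D) : [set y] = [set x] -> y = x.
  by move=> yx; have : [set x] y by rewrite -yx.
have c (u : upair) s : copy (val u).1 (val u).2 s = elt (val u).1 (val u).2 s.
  by rewrite /elt (valP u).
have N0 : @set0 (ground D) <> [set x].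
  by move=> h; have : @set0 (ground D) x by rewrite h.
case: z => [k|[u [s|s]]] /=; [move=> /e zx|move=> /e zx|by move=> /N0];
  case: z' => [k'|[u' [s'|s']]] /=; try by move=> /N0.
- by move=> /e z'x; congr inl; apply: (pdg_b_inj dP); rewrite zx.
- move=> /e z'x; exfalso; apply: (@pdg_elt_b _ _ _ dP _ _ k s' (valP u')).
  by rewrite -c z'x.
- move=> /e z'x; exfalso; apply: (@pdg_elt_b _ _ _ dP _ _ k' s (valP u)).
  by rewrite -c zx.
- move=> /e z'x.
  have [|h1 h2 h3] := @pdg_elt_inj _ _ _ dP _ _ _ _ s s' (valP u) (valP u').
    by rewrite -!c zx.
  by rewrite h3; congr (inr (_, _)); apply: val_inj; apply: injective_projections.
Qed.

Lemma origin_ex x : exists z, origin z = [set x].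
Proof.
have [[k ->]|[i [j [s [ij ->]]]]] := pdg_cover dP x; first by exists (inl k).
by exists (xel i j (inl s)); rewrite origin_el// neq_ltn ij.
Qed.

(** The [k]-th new symbol is adjoined in passing from stage [k] to stage [k + 1]. *)
Definition xlt (n : nat) : set xsymb :=
  fun s => match s with inl _ => True | inr (k, _) => (k < n)%N end.

Definition xold (n : nat) : set xground :=
  fun z => match z with inl _ => True | inr (_, s) => xlt n s end.

Lemma xlt_inv n s : xlt n s -> xlt n (xinv s).
Proof. by case: s => [|[]]. Qed.

Lemma xltS n : xlt n.+1 = xlt n `|` [set inr (n, true); xinv (inr (n, true))].
Proof.
apply/seteqP; split=> [[s|[k c]]|s].
- by left.
- rewrite /= ltnS leq_eqVlt => /predU1P[->|]; last by left.
  by right; case: c; [left|right].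
- by case=> [|[->|->]] //=; case: s => [//|[k c]] /= /ltnW.
Qed.

Lemma xold_el n (i j : 'I_4) s : i != j -> xold n (xel i j s) <-> xlt n s.
Proof.
move=> ij; case: xelP => //= u _ _ _; split; last exact: xlt_inv.
by move=> /xlt_inv; rewrite xinvK.
Qed.

Lemma xoldS n : xold n `<=` xold n.+1.
Proof. by case=> [k|[u [s|[k c]]]] //= /ltnW. Qed.

Lemma symb_finite : finite_set [set: symb D].
Proof.
have h : set_inj [set: symb D] (fun s =>
    copy (@Ordinal 4 0 isT) (@Ordinal 4 1 isT) s).
  move=> s t _ _ st.
  by have [] := @pdg_elt_inj _ _ _ dP (@Ordinal 4 0 isT) (@Ordinal 4 1 isT)
    (@Ordinal 4 0 isT) (@Ordinal 4 1 isT) s t isT isT st.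
apply: sub_finite_set (finite_preimage h finD); by [].
Qed.

Lemma xold_finite n : finite_set (xold n).
Proof.
have fin_xlt : finite_set (xlt n).
  apply: (@sub_finite_set _ _ ((inl @` setT) `|`
    ((fun kc : 'I_n * bool => inr (val kc.1, kc.2)) @` setT))).
    case=> [s|[k c]] /=; first by left; exists s.
    by move=> kn; right; exists (Ordinal kn, c).
  by rewrite finite_setU; split; apply: finite_image => //; exact: symb_finite.
apply: (@sub_finite_set _ _ ((inl @` setT) `|`
    ((fun us : upair * xsymb => inr us) @` ([set: upair] `*` xlt n)))).
  case=> [k|[u s]] /=; first by left; exists k.
  by move=> us; right; exists (u, s).
rewrite finite_setU; split; apply: finite_image => //.
apply: finite_setX fin_xlt.
exact: (@finite_finset {p : 'I_4 * 'I_4 | (p.1 < p.2)%N}).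
Qed.

Lemma xsymb_code : exists h : xsymb * xsymb * nat -> nat, injective h.
Proof.
have /countable_injP[c cinj] := finite_set_countable symb_finite.
pose cc (s : xsymb) : nat + nat * bool :=
  match s with inl s => inl (c s) | inr kc => inr kc end.
have ccinj : injective cc.
  move=> [s|kc] [t|ld] //= [] => [st|->//].
  by congr inl; apply: cinj => //; rewrite inE.
exists (fun st => pickle (cc st.1.1, cc st.1.2, st.2)).
move=> [[s t] k] [[s' t'] k'] /(pcan_inj pickleK) /= [].
by move=> /ccinj -> /ccinj -> ->.
Qed.

Definition base_rank (A : set xground) : R := rk D (\bigcup_(z in A) origin z).

Lemma base_rank_aent : aent base_rank.
Proof. exact: (aent_comap origin (almost_entropic_aent aeD)). Qed.

Lemma eltC (i j : 'I_4) (s : symb D) : i != j -> elt j i (sinv s) = elt i j s.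
Proof.
move=> ij; rewrite /elt (pdg_invK dP); case: ltngtP => // /val_inj e.
by rewrite e eqxx in ij.
Qed.

Lemma elt_tri (i j k : 'I_4) s : uniq [:: i; j; k] ->
  rk D [set elt i j s; elt k j s; elt k i (sid D)] = 2.
Proof.
rewrite uniq3E => /and3P[/eqP ij /eqP ik jk].
rewrite -(pdg_triangle dP s ij (elimN eqP jk) ik); congr (pm_rank _ _).
by rewrite eltC// eq_sym.
Qed.

Lemma rk_basis (s : seq 'I_4) : uniq s ->
  rk D [set Defs.basis D i | i in [set` s]] = (size s)%:R.
Proof.
move=> us; have := pdg_b_rank dP [set x in s]%SET.
rewrite cardsE (card_uniqP us) => <-; congr (pm_rank _ (_ @` _)).
by apply/seteqP; split=> i /=; rewrite inE.
Qed.

Lemma base_rank_good : good xbasis xel xid base_rank (xlt 0).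
Proof.
have bE (s : seq 'I_4) : uniq s -> base_rank (xbasis @` [set` s]) = (size s)%:R.
  move=> us; rewrite -(rk_basis us) /base_rank; congr (pm_rank _ _).
  apply/seteqP; split=> [x [_ [i si <-] ->]|_ [i si <-]].
    by exists i.
  by exists (xbasis i) => //; exists i.
split; first split=> [|i|i j k u|i j k l u].
- exact (aent_polym base_rank_aent).
- by have := bE [:: i] isT; rewrite !image_seq_cons image_seq_nil setU0 ?setUA.
- by have := bE _ u; rewrite !image_seq_cons image_seq_nil setU0 ?setUA.
- by have := bE _ u; rewrite !image_seq_cons image_seq_nil setU0 ?setUA.
- move=> [s|[k c]] i j // _ ij; have /eqP nij := ij.
  have [h1 h2] := pdg_rank_elt dP s nij.
  have [_ h3] := pdg_rank_elt dP (sinv s) (nesym nij).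
  have h4 : rk D [set Defs.basis D i; Defs.basis D j] = 2.
    have := @rk_basis [:: i; j]; rewrite /= inE ij => /(_ isT).
    by rewrite !image_seq_cons image_seq_nil setU0 ?setUA.
  have h5 := pdg_cl dP s nij.
  split; rewrite /base_rank ?bigcup_setU ?bigcup_set1 ?origin_el//=.
  + by rewrite -h3 eltC.
  + by rewrite h5.
- move=> [s|[? c]] i j k // _ u; have := u; rewrite uniq3E => /and3P[ij ik jk].
  rewrite /base_rank !bigcup_setU !bigcup_set1 !origin_el// 1?eq_sym//.
  by rewrite elt_tri.
Qed.

Definition xstage (n : nat) (f : set xground -> R) : Prop :=
  [/\ aent f, good xbasis xel xid f (xlt n) &
     forall A, (forall z, A z -> ~ xold n z) -> f A = 0].

Lemma base_rank_stage : xstage 0 base_rank.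
Proof.
split; [exact: base_rank_aent|exact: base_rank_good|move=> A A0].
rewrite /base_rank (_ : \bigcup_(z in A) origin z = set0) ?pm_set0//.
apply/seteqP; split=> // x [z Az].
by case: z Az => [k|[u [s|s]]] Az //; have /(_ I) := A0 _ Az.
Qed.

Lemma xstage_supp n f A : xstage n f -> f A = f (A `&` xold n).
Proof.
move=> [af _ f_null]; have pf := aent_polym af.
apply/eqP; rewrite eq_le; apply/andP; split; last first.
  by apply: (polym_mono pf) => z [].
have := polym_subadd (A `&` xold n) (A `\` xold n) pf.
by rewrite [f (A `\` _)]f_null ?setUIDK ?addr0// => z [].
Qed.

(** The four basis elements span [xold n] for every [n]; this uniform bound makes the tower
    converge. *)
Lemma xstage_bound n f : xstage n f -> f setT <= 4.
Proof.
move=> sf; have [af [[pf f1 f3 f4] fl _] _] := sf.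
pose o k (h : (k < 4)%N) := @Ordinal 4 k h.
have u : uniq [:: o 0 isT; o 1 isT; o 2 isT; o 3 isT] by [].
have fB := f4 _ _ _ _ u; rewrite -fB (xstage_supp _ sf) setTI.
set B := [set _; _; _; _].
have Bb k : B (xbasis k).
  by case: (ord4_cover k u) => ->; rewrite /B /=; tauto.
have : f (B `|` xold n) <= f B.
  apply: (polym_span_finite pf (xold_finite n)) => z.
  case: z => [k _|[u' s] us].
    by rewrite (_ : _ `|` _ = B)//; apply/seteqP; split=> [z [|->]//|z]; left.
  have u'n : (val u').1 != (val u').2.
    by apply/eqP => e; have := valP u'; rewrite e ltnn.
  have zE : inr (u', s) = xel (val u').1 (val u').2 s.
    by rewrite /xel (valP u') xcopyE.
  rewrite zE; have lz := fl _ _ _ us u'n.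
  by apply: (online_span (Frame pf f1 f3 f4) lz).
apply: le_trans; apply: (polym_mono pf) => z; by right.
Qed.

Lemma xstage_step n f x y : xstage n f -> xlt n x -> xlt n y ->
  exists g, [/\ xstage n.+1 g, forall A, A `<=` xold n -> g A = f A &
    prodr xel g x y (inr (n, true))].
Proof.
move=> sf xx xy; have [af gf f_null] := sf.
have tN : ~ xlt n (inr (n, true)) by rewrite /= ltnn.
have [|g [ag gE gg gp]] := @good_step _ _ _ _ _ _ _ xinvK xelC xel_b xel_inj
  f (xlt n) x y (inr (n, true)) af gf (@xlt_inv n) I xx xy tN; first by [].
exists g; split=> //.
- split=> //; first by rewrite xltS.
  move=> A A0; rewrite gE.
    by apply: f_null => z /A0 h /xoldS.
  by move=> i j ij /A0; apply; apply/(xold_el n.+1 _ ij); exact: ltnSn.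
- by move=> A Ao; apply: gE => i j ij /Ao h; apply: tN; apply/(xold_el n _ ij).
Qed.

Lemma xtower_ex : exists (P : polymatroid R xground),
  [/\ almost_entropic P, forall A, A `<=` xold 0 -> P A = base_rank A,
     good xbasis xel xid P setT &
     forall x y, exists t, prodr xel P x y t].
Proof.
have [h hinj] := xsymb_code.
have [dec decP] := enum_often (xid, xid) hinj.
(* A pair is treated only if both symbols exist; otherwise the pair of identities fills in, so that
   every stage adjoins exactly one new symbol with its inverse. *)
have sel_ex n : exists st : xsymb * xsymb, [/\ xlt n st.1, xlt n st.2 &
    xlt n (dec n).1 -> xlt n (dec n).2 -> st = dec n].
  have [[h1 h2]|nh] := pselect (xlt n (dec n).1 /\ xlt n (dec n).2).
    by exists (dec n).
  by exists (xid, xid); split=> // h1 h2; exfalso; apply: nh.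
have /choice[sel selP] := sel_ex.
have /choice[next nextP] : forall nf : nat * (set xground -> R), exists g,
    xstage nf.1 nf.2 -> [/\ xstage nf.1.+1 g,
      forall A, A `<=` xold nf.1 -> g A = nf.2 A &
      prodr xel g (sel nf.1).1 (sel nf.1).2 (inr (nf.1, true))].
  move=> [n f]; have [sf|] := pselect (xstage n f); last by exists f.
  have [s1 s2 _] := selP n; have [g gP] := xstage_step sf s1 s2.
  by exists g.
pose F := fix F n := if n is m.+1 then next (m, F m) else base_rank.
have FS n : xstage n (F n).
  elim: n => [|n IH]; first exact: base_rank_stage.
  by have [] := nextP (n, F n) IH.
have F_step n A : A `<=` xold n -> F n.+1 A = F n A.
  by have [_ h1 _] := nextP (n, F n) (FS n); exact: h1.
have F_prod n : prodr xel (F n.+1) (sel n).1 (sel n).2 (inr (n, true)).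
  by have [] := nextP (n, F n) (FS n).
have [||||||P [aeP PF]] := @tower_almost_entropic R xground F xold 4.
- by move=> n; have [] := FS n.
- exact: xold_finite.
- by move=> n A; exact: xstage_supp.
- exact: F_step.
- by move=> n; exact: xstage_bound.
- exact: xoldS.
have oldb n k : xold n (xbasis k) by [].
have xlt_mono m n s : (m <= n)%N -> xlt m s -> xlt n s.
  by case: s => [//|[k c]] mn /= km; exact: leq_trans mn.
have xlt_ex s : exists n, xlt n s.
  by case: s => [s|[k c]]; [exists 0|exists k.+1 => /=].
have olde n (i j : 'I_4) s : i != j -> xlt n s -> xold n (xel i j s).
  by move=> ij; apply: (xold_el n s ij).2.
have Fg n : good xbasis xel xid (F n) (xlt n) by have [] := FS n.
exists P; split=> //; first exact: PF 0.
- have [[pf f1 f3 f4] _ _] := Fg 0.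
  split; first split.
  + by split; [exact: pm_set0|exact: pm_mono|exact: pm_submod].
  + by move=> i; rewrite (PF 0) ?f1// => _ ->.
  + by move=> i j k u; rewrite (PF 0) ?f3// => _ [[]|] ->.
  + by move=> i j k l u; rewrite (PF 0) ?f4// => _ [[[]|]|] ->.
  + move=> s i j _ ij; have [n ns] := xlt_ex s.
    have [h1 h2 h3 h4 h5] := good_line (Fg n) ns ij.
    have oe := olde _ _ _ _ ij ns.
    split; rewrite (PF n)//; [by move=> _ ->|by move=> _ [] ->|by move=> _ [] ->|
      by move=> _ [] ->|by move=> _ [[]|] ->].
  + move=> s i j k _ u; have [n ns] := xlt_ex s.
    rewrite (PF n); first exact: good_tri (Fg n) _ _ _ _ ns u.
    move: u; rewrite uniq3E => /and3P[ij ik jk].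
    by move=> _ [[]|] ->; apply: olde => //; rewrite eq_sym.
- move=> x y; have [n1 xn] := xlt_ex x; have [n2 yn] := xlt_ex y.
  have [m [nm dm]] := decP (x, y) (maxn n1 n2).
  have xm : xlt m x by apply: xlt_mono xn; apply: leq_trans nm; exact: leq_maxl.
  have ym : xlt m y by apply: xlt_mono yn; apply: leq_trans nm; exact: leq_maxr.
  have [_ _ sm] := selP m; rewrite dm in sm.
  exists (inr (m, true)) => i j k u; rewrite (PF m.+1).
    by have := F_prod m i j k u; rewrite (sm xm ym).
  move: u; rewrite uniq3E => /and3P[ij ik jk].
  have xm1 : xlt m.+1 x by exact: xlt_mono xm.
  have ym1 : xlt m.+1 y by exact: xlt_mono ym.
  by move=> _ [[]|] ->; apply: olde => //=.
Qed.

(** * The limit as a partial Dowling geometry *)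

Definition xdata (P : polymatroid R xground) : pdg_data R 4 :=
  PDGData P xinv xid xbasis xcopy.

Section FromGood.
Variable P : polymatroid R xground.
Hypothesis P0 : forall A, A `<=` xold 0 -> P A = base_rank A.
Hypothesis Pgood : good xbasis xel xid P setT.

Let Pframe := good_frame Pgood.

Lemma xdata_hook (i j k : 'I_4) s t : uniq [:: i; j; k] ->
  P [set xel i j s; xel j k t] = 2.
Proof.
move=> u; have := u; rewrite uniq3E => /and3P[ij _ jk].
have [_ _ _] := online_hook Pframe u (good_line Pgood (I : setT s) ij)
  (good_line Pgood (I : setT t) jk).
by [].
Qed.

(** The first two points lie on different sides of a triangle and have rank 2 already. *)
Lemma xdata_rank2 (i j k : 'I_4) s t z : uniq [:: i; j; k] ->
  P [set xel i j s; xel j k t; z] <= 2 -> P [set xel i j s; xel j k t; z] = 2.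
Proof.
move=> u le2; apply/eqP; rewrite eq_le le2 -(xdata_hook s t u).
by apply: (polym_mono (frame_polym Pframe)) => w; left.
Qed.

Lemma uniq3_neq (i j k : 'I_4) :
  i <> j -> j <> k -> i <> k -> uniq [:: i; j; k].
Proof. by move=> /eqP ij /eqP jk /eqP ik; rewrite uniq3E ij jk ik. Qed.

Lemma xdata_pdg : is_pdg (xdata P).
Proof.
split.
- exact: xinvK.
- by rewrite /= (pdg_inv_e dP).
- by move=> i j [].
- move=> A; rewrite /= P0; last by move=> _ [i _ <-].
  rewrite -(pdg_b_rank dP A) /base_rank; congr (pm_rank _ _).
  apply/seteqP; split=> [x [_ [i iA <-] ->]|_ [i iA <-]]; first by exists i.
  by exists (xbasis i) => //; exists i.
- move=> i j k l s t ij kl /= e.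
  have [||//|[ik jl _]] := @xel_inj i j k l s t _ _ e.
  + by rewrite neq_ltn ij.
  + by rewrite neq_ltn kl.
  + by move: ij; rewrite ik jl ltnNge ltnW.
- by move=> i j k s ij; apply: xel_b; rewrite neq_ltn ij.
- case=> [k|[u s]]; [by left; exists k|right].
  exists (val u).1, (val u).2, s; split; first exact: valP u.
  by rewrite -[LHS]xcopyE /elt/= (valP u).
- move=> i j s /eqP ij; have [_ _ _ h4 h5] := good_line Pgood (I : setT s) ij.
  by rewrite /cl/= [LHS]h5 -h4.
- move=> i j s /eqP ij; have [h1 h2 _ _ _] := good_line Pgood (I : setT s) ij.
  by split.
- move=> i j k s ij jk ik; have u := uniq3_neq ij jk ik.
  apply: (xdata_rank2 u); have /eqP jk' := jk.
  have -> : xel j k (xinv s) = xel k j s by rewrite xelC// eq_sym.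
  exact: good_tri Pgood _ _ _ _ I u.
Qed.

Lemma xdata_extension : extension D (PDG xdata_pdg).
Proof.
have /choice[iE iEP] := origin_ex.
have iE_origin x z : origin z = [set x] -> iE x = z by exact: origin_inj.
have iE_inj : injective iE.
  move=> x y xy; have : [set x] = [set y] by rewrite -!iEP xy.
  by move=> e; have : [set y] x by rewrite -e.
exists iE, inl; split=> //; split; first by move=> s t [].
split.
  move=> A /=; rewrite P0.
    rewrite /base_rank; congr (pm_rank _ _); apply/seteqP; split=> [y [_ [x Ax <-]]|x Ax].
      by rewrite iEP => ->.
    by exists (iE x); [exists x|rewrite iEP].
  move=> _ [x Ax <-]; have := iEP x; case: (iE x) => [//|[u [//|s]]] /= e.
  by have : @set0 (ground D) x by rewrite e.
do 3!split=> //; first by move=> i; exact: iE_origin.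
by move=> i j s ij; apply: iE_origin; rewrite -origin_el// neq_ltn ij.
Qed.

Lemma xdata_product x y t : prodr xel P x y t ->
  geometric_product (D := PDG xdata_pdg) x y t.
Proof.
move=> pt i j k ij jk ik; have u := uniq3_neq ij jk ik.
apply: (xdata_rank2 u); have /eqP ik' := ik.
have -> : elt (D := xdata P) k i (xinv t) = xel i k t by exact: xelC.
exact: pt.
Qed.

End FromGood.
End Extension.

Theorem theorem5p7 (R : realType) (D : pdg R 4)
    (finD : pdg_finite D) (aeD : pdg_almost_entropic D) :
  exists D' : pdg R 4,
    extension D D' /\
    pdg_almost_entropic D' /\
    (forall s s' : symb D', exists t : symb D', geometric_product s s' t).
Proof.
have [P [aeP P0 Pg Pp]] := xtower_ex finD aeD.
exists (PDG (xdata_pdg P0 Pg)); split; first exact: xdata_extension.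
split=> // s s'; have [t pt] := Pp s s'; exists t.
exact: xdata_product.
Qed.
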